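(* Let $L\ge 1$ and let $K$ be an index set. For each $N\in\mathbb N$ let $\mathbf A_{N,1}=(A_{N,1}^{(k)})_{k\in K},\ldots,\mathbf A_{N,L}=(A_{N,L}^{(k)})_{k\in K}$ be independent families of $N\times N$ random matrices which are uniformly bounded in operator norm. Assume moreover that each family is permutation invariant. Then $\mathbf A_{N,1},\ldots,\mathbf A_{N,L}$ are asymptotically free with amalgamation over $\mathcal D_N$ in the following sense. For any $n\ge 2$, any $\ell_1,\ldots,\ell_n\in\{1,\ldots,L\}$ with $\ell_1\ne\ell_2\ne\cdots\ne\ell_n$ (consecutive indices distinct), and any monomials $P_{N,1},\ldots,P_{N,n}\in\mathcal D_N\langle X_k:k\in K\rangle$ (for each $N$) whose degrees and the norms of whose coefficients are bounded uniformly in $N$, the matrix $$\varepsilon_N:=\Delta\Big[\big(P_{N,1}(\mathbf A_{N,\ell_1})-\Delta P_{N,1}(\mathbf A_{N,\ell_1})\big)\cdots\big(P_{N,n}(\mathbf A_{N,\ell_n})-\Delta P_{N,n}(\mathbf A_{N,\ell_n})\big)\Big]$$ satisfies, for every $p\ge 1$, $$\mathbb E\Big[\tfrac1N\mathrm{Tr}\big[(\varepsilon_N\varepsilon_N^* )^p\big]\Big]\underset{N\to\infty}{\longrightarrow}0 .$$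
   Context: $\mathcal M_N$ is the algebra of $N\times N$ complex matrices, $\mathcal D_N$ the subalgebra of (deterministic) diagonal matrices. The diagonal map is $\Delta A=(\delta_{i,j}A(i,j))_{i,j=1}^N$; it is applied to random matrices entrywise (realization by realization). $\mathcal D_N\langle X_k:k\in K\rangle$ is the algebra generated by freely noncommuting indeterminates $(X_k)_{k\in K}$ and $\mathcal D_N$. A monomial is $P=b_0X_{k_1}b_1X_{k_2}\cdots X_{k_d}b_d$ with $b_j\in\mathcal D_N$; its degree is $d$ and its coefficients are $b_0,\ldots,b_d$; norms of coefficients are operator norms. $P(\mathbf A_{N,\ell})$ is obtained by substituting $X_k=A_{N,\ell}^{(k)}$. Independence: for each $N$, the $L$ families are independent. Uniformly bounded in operator norm: there is a constant $C$ such that almost surely $\|A_{N,\ell}^{(k)}\|\le C$ for all $N,\ell,k$. The index set $K$ does not depend on $N$. A family $\mathbf A_N=(A_N^{(k)})_{k\in K}$ of random matrices is permutation invariant if for every permutation matrix $S$ of size $N$ the families $(A_N^{(k)})_{k\in K}$ and $(SA_N^{(k)}S^{-1})_{k\in K}$ have the same joint distribution. *)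

(* Defs.v *)
From HB Require Import structures.
From mathcomp Require Import all_boot all_order all_algebra.
From mathcomp Require Import complex.
From mathcomp Require Import all_classical all_reals all_analysis.

Set Implicit Arguments.
Unset Strict Implicit.
Unset Printing Implicit Defensive.

Import Order.TTheory GRing.Theory Num.Theory.
Import numFieldNormedType.Exports.

Local Open Scope classical_set_scope.
Local Open Scope ring_scope.
Local Open Scope complex_scope.

Section Matrices.
Variable (R : realType) (N : nat).
Implicit Types A : 'M[R[i]]_N.

Definition enorm (v : 'cV[R[i]]_N) : R :=
  Num.sqrt (\sum_i ComplexField.Normc.normc (v i 0) ^+ 2).

Definition opnorm A : R :=
  sup [set enorm (A *m v) | v in [set v | enorm v <= 1]].

Definition diag_part A : 'M[R[i]]_N := \matrix_(i, j) ((i == j)%:R * A i j).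

Definition adjoint A : 'M[R[i]]_N := (map_mx Num.conj A)^T.

(* The value is 0 for N = 0, as 0^-1 = 0. *)
Definition ntrace A : R[i] := N%:R^-1 * \tr A.

End Matrices.

Section Monomials.
Variables (R : realType) (K : Type) (N : nat).

(* The formal expression b_0 X_(k_1) b_1 ... X_(k_d) b_d, stored as b_0 and
   the list of the pairs (k_j, b_j), 1 <= j <= d. An element b of the algebra
   of diagonal matrices is given by its diagonal: it stands for diag_mx b. *)
Record monomial := Monomial {
  mon_head : 'rV[R[i]]_N ;
  mon_tail : seq (K * 'rV[R[i]]_N)
}.

Definition mon_degree (P : monomial) : nat := size (mon_tail P).

Definition mon_coefs (P : monomial) : seq 'M[R[i]]_N :=
  diag_mx (mon_head P) :: [seq diag_mx kb.2 | kb <- mon_tail P].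

Definition mon_eval (P : monomial) (a : K -> 'M[R[i]]_N) : 'M[R[i]]_N :=
  diag_mx (mon_head P) * \prod_(kb <- mon_tail P) (a kb.1 * diag_mx kb.2).

End Monomials.

Section RandomFamilies.
Variables (R : realType) (K : Type) (N : nat).

(* The product sigma-algebra on the space of families (a_k)_(k in K) of complex
   matrices: it is generated by the real and imaginary parts of the entries. *)
Definition family_sigma : set (set (K -> 'M[R[i]]_N)) :=
  <<s [set E | exists (k : K) (i j : 'I_N) (B : set R), measurable B /\
         (E = [set a : K -> 'M[R[i]]_N | B (complex.Re (a k i j))] \/
          E = [set a : K -> 'M[R[i]]_N | B (complex.Im (a k i j))])] >>.

Variables (d : measure_display) (T : measurableType d).

Definition random_family (X : T -> K -> 'M[R[i]]_N) : Prop :=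
  forall k i j,
    measurable_fun [set: T] (fun w => complex.Re (X w k i j)) /\
    measurable_fun [set: T] (fun w => complex.Im (X w k i j)).

Variable P : probability T R.

Definition same_distribution (X Y : T -> K -> 'M[R[i]]_N) : Prop :=
  forall E, family_sigma E -> P (X @^-1` E) = P (Y @^-1` E).

Definition permutation_invariant (X : T -> K -> 'M[R[i]]_N) : Prop :=
  forall S : 'M[R[i]]_N, is_perm_mx S ->
    same_distribution X (fun w k => S *m X w k *m invmx S).

(* Since E l = setT is allowed, this contains the product rule for every
   subset of the L families. *)
Definition independent_families (L : nat)
    (X : 'I_L -> T -> K -> 'M[R[i]]_N) : Prop :=
  forall E : 'I_L -> set (K -> 'M[R[i]]_N),
    (forall l, family_sigma (E l)) ->
    P (\bigcap_(l in [set: 'I_L]) (X l @^-1` E l)) =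
    (\prod_(l < L) P (X l @^-1` E l))%E.

End RandomFamilies.

(* The big product over 'I_n is taken in increasing order of the index. *)
Definition freeness_defect (R : realType) (K : Type) (N L n : nat)
    (a : 'I_L -> K -> 'M[R[i]]_N) (l : 'I_n -> 'I_L)
    (P : 'I_n -> monomial R K N) : 'M[R[i]]_N :=
  diag_part (\prod_(i < n) (mon_eval (P i) (a (l i)) -
                           diag_part (mon_eval (P i) (a (l i))))).

(* Main.v *)
From HB Require Import structures.
Require Import Defs.
From mathcomp Require Import all_boot all_order all_algebra.
From mathcomp Require Import fingroup perm complex ring lra.
From mathcomp Require Import all_classical all_reals all_analysis.
From mathcomp Require Import measurable_realfun.

(** The error matrix [eps] is diagonal with uniformly bounded entries, so all its
    moments are controlled by the second one, the expectation of
    [1/N \sum_x |eps x x|^2].  Expanding the product of the [n] centred blocks,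
    this is a sum over pairs of closed paths based at [x] of products of entries
    of the blocks and of their conjugates.

    The deterministic coefficients break the permutation invariance.  It is
    recovered by colouring the indices: round the values of all the coefficients
    to finitely many values, and give two indices the same colour when all their
    rounded values agree.  The number of colours does not depend on [N], the
    rounding is a small perturbation in operator norm ([blocks_perturb]), and the
    rounded blocks are covariant under the group [G] of the colour preserving
    permutations ([mon_eval_perm_conj]).  Since the families are independent and
    invariant, their joint law is unchanged when each of them is conjugated by
    its own permutation ([integral_permute]).  The expectation is thus an average
    over [G^L] of a deterministic quantity ([expectation_defect_le]), for which a
    bound holds for all bounded matrices with zero diagonal ([word_average_le]).

    For a given pair of paths, the average over [G^L] is the product over the
    families of averages over [G].  Write [N_y] for the number of indices that
    have the colour of [y].  In each factor, every index [y] touched by an edge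
    of the family gains [N_y^(-1/2)] ([orbit_average_le]).  An index of the paths
    other than [x] lies between two consecutive blocks, hence between blocks of
    different families: it gains [N_y^(-1)], while [x] gains at least
    [N_x^(-1/2)], which is at most [N^(1/2) N_x^(-1)].  As the sum of [1/N_y]
    over all [y] is at most the number of colours, the sum over all paths is
    [O(N^(1/2))], and dividing by [N] makes it vanish in the limit.

    For [orbit_average_le], the average over [G] is an average over the injective
    and colour preserving maps from the touched indices [Y] to all indices.  There
    are at least a constant times [\prod_(y in Y) N_y] of these, so their sum has
    to be bounded by a constant times the square root of this number.  The
    constraint of injectivity is a product of terms [1 - (phi a == phi b)], hence
    expands into edges labelled by the identity matrix, and there remains a sum
    over all labellings of a graph.  As the blocks have zero diagonal, the graph
    has no loops, and its vertices are split into two sides such that each vertex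
    has a neighbour on the other side.  The product over the edges that join the
    two sides is the kernel of a compression of a tensor product of contractions;
    the edges inside a side act by multiplication by bounded functions.  The sum
    is therefore a matrix coefficient of a contraction between two vectors whose
    norms are the square roots of the numbers of labellings of the two sides
    ([graph_sum_le]). *)

Set Implicit Arguments.
Unset Strict Implicit.
Unset Printing Implicit Defensive.
Import Order.TTheory GRing.Theory Num.Theory.
Import numFieldNormedType.Exports.
Local Open Scope ring_scope.

(** * Operators bounded in squared norm *)

Definition sqnorm (C : numClosedFieldType) (X : finType) (w : X -> C) : C :=
  \sum_x `|w x| ^+ 2.

(** [c] bounds the square of the operator norm of [k]. *)
Definition sqbounded (C : numClosedFieldType) (c : C) (X Y : finType)
    (k : X -> Y -> C) : Prop :=
  forall w : Y -> C, sqnorm (fun x => \sum_y k x y * w y) <= c * sqnorm w.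

Notation contraction := (sqbounded 1).

Section Contractions.
Variable C : numClosedFieldType.

Lemma sqnorm_ge0 (X : finType) (w : X -> C) : 0 <= sqnorm w.
Proof. by apply: sumr_ge0 => x _; rewrite exprn_ge0. Qed.

Lemma cauchy_schwarz (I : finType) (D : {pred I}) (u z : I -> C) :
  `|\sum_(i in D) u i * z i| ^+ 2 <=
  (\sum_(i in D) `|u i| ^+ 2) * (\sum_(i in D) `|z i| ^+ 2).
Proof.
set a := fun i => `|u i|; set b := fun i => `|z i|.
have le1 : `|\sum_(i in D) u i * z i| <= \sum_(i in D) a i * b i.
  by apply: le_trans (ler_norm_sum _ _ _) _; apply: ler_sum => i _; rewrite normrM.
apply: (@le_trans _ _ ((\sum_(i in D) a i * b i) ^+ 2)).
  by rewrite lerXn2r // nnegrE ?sumr_ge0 // => i _; rewrite mulr_ge0 /a /b.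
(* the identity of Lagrange *)
have : 0 <= \sum_(i in D) \sum_(j in D) (a i * b j - a j * b i) ^+ 2.
  apply: sumr_ge0 => i _; apply: sumr_ge0 => j _.
  by apply: real_exprn_even_ge0 => //; rewrite rpredB ?rpredM /a /b ?normr_real.
have -> : \sum_(i in D) \sum_(j in D) (a i * b j - a j * b i) ^+ 2 =
   2 * ((\sum_(i in D) a i ^+ 2) * (\sum_(i in D) b i ^+ 2) -
        (\sum_(i in D) a i * b i) ^+ 2).
  have sqE i j : (a i * b j - a j * b i) ^+ 2 = a i ^+ 2 * b j ^+ 2
      + b i ^+ 2 * a j ^+ 2 - 2 * (a i * b i) * (a j * b j) by ring.
  under eq_bigr do (under eq_bigr do rewrite sqE;
    rewrite sumrB big_split /= -!mulr_sumr).
  rewrite sumrB big_split /= -!mulr_suml -mulr_sumr; ring.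
by rewrite pmulr_rge0 ?ltr0n // subr_ge0.
Qed.

Lemma sqbounded_form (c : C) (X Y : finType) (k : X -> Y -> C) :
  sqbounded c k -> forall u w,
  `|\sum_x \sum_y u x * k x y * w y| ^+ 2 <= c * sqnorm u * sqnorm w.
Proof.
move=> kc u w.
under eq_bigr do (under eq_bigr do rewrite -mulrA; rewrite -mulr_sumr).
apply: le_trans (cauchy_schwarz _ _ _) _.
rewrite [c * _]mulrC -mulrA; apply: ler_wpM2l; first exact: sqnorm_ge0.
exact: kc.
Qed.

(** Boundedness passes to the transpose because it is a property of the
    bilinear form [u, w |-> \sum u x * k x y * w y], which is symmetric in the
    two variables: testing it on the conjugate of the image of [w] gives back
    the bound on operators. *)
Lemma sqbounded_tr (c : C) (X Y : finType) (k : X -> Y -> C) : 0 <= c ->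
  sqbounded c k -> sqbounded c (fun y x => k x y).
Proof.
move=> c0 kc u; set z := fun y => \sum_x k x y * u x; set s := sqnorm z.
have /= := sqbounded_form kc u (fun y => (z y)^*).
have -> : \sum_x \sum_y u x * k x y * (z y)^* = s.
  rewrite exchange_big; apply: eq_bigr => y _ /=.
  by rewrite -mulr_suml normCK /z; under eq_bigr do rewrite mulrC.
have -> : sqnorm (fun y => (z y)^*) = s.
  by apply: eq_bigr => y _; rewrite norm_conjC.
have s0 : 0 <= s by apply: sqnorm_ge0.
rewrite ger0_norm // expr2.
have [-> _|s1] := eqVneq s 0; first by rewrite mulr_ge0 ?sqnorm_ge0.
by rewrite ler_pM2r // lt0r s1.
Qed.

Lemma sqbounded_conj (c : C) (X Y : finType) (k : X -> Y -> C) :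
  sqbounded c k -> sqbounded c (fun x y => (k x y)^*).
Proof.
move=> kc w; have := kc (fun y => (w y)^*); congr (_ <= _ * _).
  apply: eq_bigr => x _; rewrite -[in RHS]norm_conjC rmorph_sum.
  by congr (`|_| ^+ 2); apply: eq_bigr => y _; rewrite rmorphM /= conjCK.
by apply: eq_bigr => y _; rewrite norm_conjC.
Qed.

Lemma sqbounded_entry (c : C) (X Y : finType) (k : X -> Y -> C) :
  sqbounded c k -> forall x y, `|k x y| ^+ 2 <= c.
Proof.
move=> kc x y; have := kc (fun y' => (y' == y)%:R).
have -> : sqnorm (fun y' => (y' == y)%:R : C) = 1.
  rewrite /sqnorm (bigD1 y) //= eqxx normr1 expr1n big1 ?addr0 // => i /negPf ->.
  by rewrite normr0 expr0n.
rewrite mulr1; apply: le_trans; rewrite /sqnorm (bigD1 x) //=.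
rewrite (bigD1 y) //= eqxx mulr1 big1 ?addr0; last first.
  by move=> i /negPf ->; rewrite mulr0.
by rewrite lerDl sumr_ge0 // => i _; rewrite exprn_ge0.
Qed.

Lemma contraction_entry (X Y : finType) (k : X -> Y -> C) :
  contraction k -> forall x y, `|k x y| <= 1.
Proof.
by move=> /sqbounded_entry kc x y; have := kc x y; rewrite expr_le1.
Qed.

Lemma contraction_id (X : finType) : contraction (fun x y : X => (x == y)%:R : C).
Proof.
move=> w; rewrite mul1r le_eqVlt; apply/orP; left; apply/eqP.
apply: eq_bigr => x _; rewrite (bigD1 x) //= eqxx mul1r big1 ?addr0 // => i.
by rewrite eq_sym => /negPf ->; rewrite mul0r.
Qed.

Lemma sum_pair (V : nmodType) (I J : finType) (F : I * J -> V) :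
  \sum_p F p = \sum_i \sum_j F (i, j).
Proof. by rewrite pair_bigA; apply: eq_bigr => -[]. Qed.

(** [k1] tensor [k2] is the composite of [k1] tensor the identity and of the
    identity tensor [k2]. *)
Lemma contraction_tensor (X1 X2 Y1 Y2 : finType) (k1 : X1 -> Y1 -> C)
    (k2 : X2 -> Y2 -> C) : contraction k1 -> contraction k2 ->
  contraction (fun (x : X1 * X2) (y : Y1 * Y2) => k1 x.1 y.1 * k2 x.2 y.2).
Proof.
move=> k1c k2c w; rewrite mul1r /sqnorm.
rewrite !sum_pair /=.
apply: (@le_trans _ _ (\sum_y1 \sum_x2 `|\sum_y2 k2 x2 y2 * w (y1, y2)| ^+ 2)).
  rewrite exchange_big [leRHS]exchange_big; apply: ler_sum => x2 _ /=.
  have := k1c (fun y1 => \sum_y2 k2 x2 y2 * w (y1, y2)).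
  rewrite mul1r; congr (_ <= _); apply: eq_bigr => x1 _; congr (`|_| ^+ 2).
  rewrite sum_pair /=.
  by apply: eq_bigr => y1 _; rewrite mulr_sumr; apply: eq_bigr => *; rewrite mulrA.
by apply: ler_sum => y1 _; have := k2c (fun y2 => w (y1, y2)); rewrite mul1r.
Qed.

(** Labelling part of the coordinates injectively by [I] and [J] amounts to
    compressing the operator to coordinate subspaces. *)
Lemma contraction_compress (I J X Y : finType) (k : X -> Y -> C) (DI : {pred I})
    (DJ : {pred J}) (p : I -> X) (q : J -> Y) (u : I -> C) (w : J -> C) :
  contraction k -> {in DI &, injective p} -> {in DJ &, injective q} ->
  (forall i, `|u i| <= 1) -> (forall j, `|w j| <= 1) ->
  `|\sum_(i in DI) \sum_(j in DJ) u i * w j * k (p i) (q j)| ^+ 2 <=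
  #|DI|%:R * #|DJ|%:R.
Proof.
move=> kc pI qI u1 w1.
under eq_bigr do (under eq_bigr do rewrite -mulrA; rewrite -mulr_sumr).
have le1 (I' : finType) (D : {pred I'}) (f : I' -> C) :
    (forall i, `|f i| <= 1) -> \sum_(i in D) `|f i| ^+ 2 <= #|D|%:R.
  move=> f1; rewrite -sum1_card natr_sum; apply: ler_sum => i _.
  by rewrite exprn_ile1.
apply: le_trans (cauchy_schwarz _ _ _) _.
apply: ler_pM; rewrite ?le1 //; try by apply: sumr_ge0 => *; rewrite exprn_ge0.
(* [w'] is [w] seen as a vector indexed by [Y]; its norm is that of [w] because
   the fibres of [q] in [DJ] have at most one element *)
pose w' y := \sum_(j in DJ | q j == y) w j.
apply: (@le_trans _ _ (sqnorm w')); last first.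
  apply: le_trans (le1 _ DJ w w1); rewrite /sqnorm.
  rewrite [leRHS](partition_big q predT) //=; apply: ler_sum => y _.
  rewrite /w'; case: (pickP [pred j in DJ | q j == y]) => [j /=|nj]; last first.
    by rewrite !big_pred0 // normr0 expr0n.
  move=> /andP[jD /eqP qj]; rewrite !(big_pred1 j) // => i /=;
    apply/andP/eqP => [[iD /eqP qi]|->]; rewrite ?qj //;
    by apply: qI => //; rewrite qi qj.
have := kc w'; rewrite mul1r; apply: le_trans; rewrite /sqnorm.
pose z x := \sum_y k x y * w' y.
have -> : \sum_(i in DI) `|\sum_(i0 in DJ) w i0 * k (p i) (q i0)| ^+ 2 =
          \sum_(i in DI) `|z (p i)| ^+ 2.
  apply: eq_bigr => i _; congr (`|_| ^+ 2); rewrite (partition_big q predT) //=.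
  apply: eq_bigr => y _; rewrite /w' mulr_sumr; apply: eq_bigr => j.
  by move=> /andP[_ /eqP ->]; rewrite mulrC.
rewrite -(big_imset (fun x => `|z x| ^+ 2) pI) /=.
rewrite [leRHS](bigID [in [set p x | x in DI]]) /= lerDl.
by apply: sumr_ge0 => x _; rewrite exprn_ge0.
Qed.

End Contractions.

(** * Sums over the labellings of a graph *)

Section GraphSums.
Variables (C : numClosedFieldType) (X V : finType) (E : eqType).
Variables (k : E -> X -> X -> C) (s t : E -> V).
Implicit Types (phi psi : {ffun V -> X}) (es : seq E) (S : {set V}).

Definition merge S phi psi : {ffun V -> X} :=
  [ffun v => if v \in S then phi v else psi v].

Definition crossing S e := (s e \in S) != (t e \in S).

Definition end_in S e := if s e \in S then s e else t e.
Definition end_out S e := if s e \in S then t e else s e.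

(** The product over the edges, for a fixed bipartition of the vertices: the
    edges inside [S] (outside [S]) give a multiplication operator [u] (resp.
    [w]), and the crossing edges give a compression of the tensor product of
    their kernels. *)
Lemma edge_product_split S es : (forall e, e \in es -> contraction (k e)) ->
  exists (X1 Y1 : finType) (K : X1 -> Y1 -> C) (p : {ffun V -> X} -> X1)
    (q : {ffun V -> X} -> Y1) (u w : {ffun V -> X} -> C),
  [/\ contraction K, (forall phi, `|u phi| <= 1), (forall phi, `|w phi| <= 1),
      (forall phi psi,
         \prod_(e <- es) k e (merge S phi psi (s e)) (merge S phi psi (t e)) =
         u phi * w psi * K (p phi) (q psi)) &
      (forall phi phi', p phi = p phi' -> forall e, e \in es -> crossing S e ->
         phi (end_in S e) = phi' (end_in S e)) /\
      (forall psi psi', q psi = q psi' -> forall e, e \in es -> crossing S e ->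
         psi (end_out S e) = psi' (end_out S e))].
Proof.
elim: es => [_|e es IH kc].
  exists unit, unit, (fun _ _ => 1), (fun=> tt), (fun=> tt), (fun=> 1), (fun=> 1).
  split=> [w|||phi psi|//]; rewrite ?normr1 //; last by rewrite big_nil !mulr1.
  rewrite mul1r le_eqVlt; apply/orP; left; apply/eqP.
  by apply: eq_bigr => -[] _; rewrite (bigD1 tt) //= big1 ?addr0 ?mul1r // => -[].
have [|X1 [Y1 [K [p [q [u [w [Kc u1 w1 prodE [pI qI]]]]]]]]] := IH.
  by move=> e' e'es; apply: kc; rewrite inE e'es orbT.
have ke : contraction (k e) by apply: kc; rewrite mem_head.
case crossE: (crossing S e); last first.
  exists X1, Y1, K, p, q,
    (fun phi => (if s e \in S then k e (phi (s e)) (phi (t e)) else 1) * u phi),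
    (fun psi => (if s e \in S then 1 else k e (psi (s e)) (psi (t e))) * w psi).
  move/negbFE/eqP: crossE => crossE.
  split; first exact: Kc; last first.
  - by split=> phi phi' pE e'; rewrite inE => /predU1P[->|]; do ?[exact: pI|exact: qI];
      rewrite /crossing crossE eqxx.
  - by move=> phi psi; rewrite big_cons prodE /merge !ffunE -crossE; case: ifP => _; ring.
  - by move=> psi; rewrite normrM mulr_ile1 //; case: ifP => _; rewrite ?normr1 ?contraction_entry.
  by move=> phi; rewrite normrM mulr_ile1 //; case: ifP => _; rewrite ?normr1 ?contraction_entry.
exists (X * X1)%type, (X * Y1)%type,
  (fun x y => (if s e \in S then k e x.1 y.1 else k e y.1 x.1) * K x.2 y.2),
  (fun phi => (phi (end_in S e), p phi)), (fun psi => (psi (end_out S e), q psi)),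
  u, w; split; [|exact: u1|exact: w1| |].
- case: (s e \in S).
    exact: (contraction_tensor ke Kc).
  exact: (contraction_tensor (sqbounded_tr ler01 ke) Kc).
- move=> phi psi; rewrite big_cons prodE /merge !ffunE /= /end_in /end_out.
  by move: crossE; rewrite /crossing; case: ifP; case: ifP => // *; ring.
by split=> phi phi' [E1 E2] e'; rewrite inE => /predU1P[->|] //;
   [exact: pI|exact: qI].
Qed.

Lemma card_family_prod (F : V -> {set X}) :
  #|family (fun v => mem (F v))| = (\prod_v #|F v|)%N.
Proof.
transitivity (\prod_v \sum_(x in F v) 1)%N.
  by rewrite bigA_distr_big_dep -sum1_card; apply: eq_bigr => f _; rewrite big1_eq.
by apply: eq_bigr => v _; rewrite sum1_card.
Qed.

(** The trivial bound on the sum is the number of maps, and cancellations improve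
    it to the square root.  They require each vertex to carry a crossing edge or
    to be frozen at one value: this makes the labelling of the coordinates of the
    tensor product by the maps injective. *)
Lemma graph_sum_le S es (F : V -> {set X}) (x0 : X) :
    (forall e, e \in es -> contraction (k e)) ->
    (forall v, (#|F v| <= 1)%N \/
       exists e, [/\ e \in es, crossing S e & v = s e \/ v = t e]) ->
  `|\sum_(phi in family (fun v => mem (F v)))
     \prod_(e <- es) k e (phi (s e)) (phi (t e))| ^+ 2 <= (\prod_v #|F v|)%:R.
Proof.
move=> kc cover.
have [X1 [Y1 [K [p [q [u [w [Kc u1 w1 prodE [pI qI]]]]]]]]] := edge_product_split S kc.
pose F1 v := if v \in S then F v else [set x0].
pose F2 v := if v \in S then [set x0] else F v.
pose D1 := family (fun v => mem (F1 v)); pose D2 := family (fun v => mem (F2 v)).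
have F'P (F' : V -> {set X}) (phi : {ffun V -> X}) :
  reflect (forall v, phi v \in F' v) (phi \in family (fun v => mem (F' v))).
  exact: familyP.
have F1P phi : phi \in D1 -> forall v, phi v \in F1 v by move/familyP.
have F2P phi : phi \in D2 -> forall v, phi v \in F2 v by move/familyP.
(* a labelling is a pair of labellings of the two sides, each extended by the
   constant [x0] on the other side *)
pose c0 : {ffun V -> X} := [ffun=> x0].
have -> : \sum_(phi in family (fun v => mem (F v)))
    \prod_(e <- es) k e (phi (s e)) (phi (t e)) =
  \sum_(phi in D1) \sum_(psi in D2) u phi * w psi * K (p phi) (q psi).
  rewrite pair_big /= (reindex_onto (fun r => merge S r.1 r.2)
    (fun phi => (merge S phi c0, merge S c0 phi))) /=; last first.
    by move=> phi _; apply/ffunP => v; rewrite !ffunE /=; case: (v \in S).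
  apply: eq_big => [[phi psi]|[phi psi] _] /=; last by rewrite prodE.
  apply/andP/andP => [[/F'P fam /eqP[m1 m2]]|[f1 f2]].
    split; apply/F'P => v; have := fam v; rewrite /F1 /F2 !ffunE.
      have := congr1 (fun f : {ffun V -> X} => f v) m1.
      by rewrite !ffunE; case: (v \in S) => // <-; rewrite set11.
    have := congr1 (fun f : {ffun V -> X} => f v) m2.
    by rewrite !ffunE; case: (v \in S) => // <-; rewrite set11.
  split.
    apply/F'P => v; have := F1P _ f1 v; have := F2P _ f2 v.
    by rewrite ffunE /F1 /F2; case: ifP.
  rewrite xpair_eqE; apply/andP; split; apply/eqP/ffunP => v;
    have := F1P _ f1 v; have := F2P _ f2 v;
    by rewrite !ffunE /F1 /F2; case: ifP => // _; rewrite !inE => /eqP ? /eqP ?.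
have -> : (\prod_v #|F v|)%:R = #|D1|%:R * #|D2|%:R :> C.
  rewrite -natrM !card_family_prod -big_split /=; congr (_%:R).
  by apply: eq_bigr => v _; rewrite /F1 /F2; case: ifP; rewrite cards1 ?muln1 ?mul1n.
apply: contraction_compress => // phi phi' f1 f2 pE; apply/ffunP => v;
  have := f1; have := f2.
- move=> /F1P/(_ v) + /F1P/(_ v); rewrite /F1.
  case: ifP => [vS a b|_ /set1P -> /set1P ->] //.
  have [/card_le1_eqP c1|[e [ees cr ve]]] := cover v; first exact: c1.
  have -> : v = end_in S e; last exact: pI.
  move: cr vS; rewrite /crossing /end_in.
  by case: ve => ->; case: (s e \in S); case: (t e \in S).
move=> /F2P/(_ v) + /F2P/(_ v); rewrite /F2.
case: ifP => [_ /set1P -> /set1P ->|vS a b] //.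
have [/card_le1_eqP c1|[e [ees cr ve]]] := cover v; first exact: c1.
have -> : v = end_out S e; last exact: qI.
move: cr vS; rewrite /crossing /end_out.
by case: ve => ->; case: (s e \in S); case: (t e \in S).
Qed.

End GraphSums.

Section InjectiveSums.
Variables (C : numClosedFieldType) (X V : finType) (E : eqType).
Variables (k : E -> X -> X -> C) (s t : E -> V).
Implicit Types (phi : {ffun V -> X}) (es : seq E) (S : {set V}).

(** Imposing [phi p.1 != phi p.2] for the pairs of [ps] costs only a constant,
    because [phi a == phi b] is an edge labelled by the identity kernel: the
    product of the [1 - (phi a == phi b)] expands into [2 ^ size ps] sums over
    graphs with more edges, to which the same bound applies. *)
Lemma graph_sum_distinct_le S es (F : V -> {set X}) (x0 : X)
    (ps qs : seq (V * V)) :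
    (forall e, e \in es -> contraction (k e)) ->
    (forall v, (#|F v| <= 1)%N \/
       exists e, [/\ e \in es, crossing s t S e & v = s e \/ v = t e]) ->
  `|\sum_(phi in family (fun v => mem (F v)))
     \prod_(p <- ps) (1 - (phi p.1 == phi p.2)%:R) *
     \prod_(q <- qs) (phi q.1 == phi q.2)%:R *
     \prod_(e <- es) k e (phi (s e)) (phi (t e))| <=
  2 ^+ size ps * sqrtC (\prod_v #|F v|)%:R.
Proof.
(* the pairs of [qs] are those for which the term [phi a == phi b] of the
   expansion has been chosen *)
move=> kc cover; elim: ps qs => [|p ps IH] qs.
  pose k' (e : E + V * V) := if e is inl e then k e else fun x y => (x == y)%:R.
  pose s' (e : E + V * V) := match e with inl e => s e | inr q => q.1 end.
  pose t' (e : E + V * V) := match e with inl e => t e | inr q => q.2 end.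
  have := @graph_sum_le C X V (E + V * V)%type k' s' t' S
    ([seq inr q | q <- qs] ++ [seq inl e | e <- es]) F x0.
  rewrite mul1r => bound; rewrite -[leLHS]sqrCK ?normr_ge0 //.
  rewrite ler_sqrtC ?qualifE /= ?exprn_ge0 //.
  under eq_bigr do rewrite big_nil mul1r.
  under eq_bigr do rewrite -(big_map inr predT
    (fun e => k' e (_ (s' e)) (_ (t' e)))) -(big_map inl predT
    (fun e => k' e (_ (s' e)) (_ (t' e)))) -big_cat.
  apply: bound => [e|v].
    rewrite mem_cat => /orP[/mapP[q _ ->]|/mapP[e' e'es ->]] /=.
      exact: contraction_id.
    exact: kc.
  have [|[e [ees cr ve]]] := cover v; [by left|right].
  by exists (inl e); split=> //; rewrite mem_cat map_f ?orbT.
rewrite /= exprS -mulrA [2]/(1 + 1) mulrDl mul1r.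
apply: le_trans (lerD (IH qs) (IH (p :: qs))).
rewrite -[X in _ + X]normrN -sumrN; apply: le_trans (ler_normD _ _).
rewrite -big_split /=; rewrite le_eqVlt; apply/orP; left.
apply/eqP; congr (`|_|); apply: eq_bigr => phi _.
by rewrite !big_cons; ring.
Qed.

(** A maximal independent set of vertices separates, for each vertex that is
    not isolated, this vertex from one of its neighbours. *)
Lemma crossing_bipartition es : (forall e, e \in es -> s e != t e) ->
  exists S : {set V}, forall v e, e \in es -> v = s e \/ v = t e ->
    exists e', [/\ e' \in es, crossing s t S e' & v = s e' \/ v = t e'].
Proof.
move=> noloop.
pose indep := [pred S : {set V} | all (fun e => ~~ ((s e \in S) && (t e \in S))) es].
have [|S /maxsetP[/= /allP iS maxS]] := @ex_maxset _ indep.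
  by exists finset.set0; apply/allP => e _; rewrite !inE.
exists S => v e ees ve.
have [vS|vS] := boolP (v \in S).
  exists e; split=> //; have := iS _ ees; rewrite /crossing.
  by case: ve vS => ->; [move=> ->|move=> ->; rewrite andbT]; case: (_ \in S).
have /allPn[e' e'es] : ~~ indep (v |: S).
  apply/negP => /maxS/(_ (finset.subsetUr _ _)) SE.
  by move: vS; rewrite -SE setU11.
rewrite negbK !in_setU1 => /andP[a b].
exists e'; have := iS _ e'es; have := noloop _ e'es; rewrite /crossing.
case/orP: a => [/eqP a|a]; case/orP: b => [/eqP b|b].
- by rewrite a b eqxx.
- by rewrite b a (negPf vS) => _ _; split=> //; left.
- by rewrite a b (negPf vS) => _ _; split=> //; right.
by rewrite a b.
Qed.

End InjectiveSums.

(** * Colour preserving permutations *)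

Section ColouredPermutations.
Variables (X Col : finType) (c : X -> Col).
Implicit Types (g : {perm X}) (x y : X) (Y : {set X}).

Definition colour_perms : {set {perm X}} := [set g : {perm X} | [forall x, c (g x) == c x]].

Definition colour_class x : {set X} := [set y | c y == c x].

Lemma colour_permsP g : reflect (forall x, c (g x) = c x) (g \in colour_perms).
Proof. by rewrite inE; apply: (iffP forallP) => cg x; apply/eqP. Qed.

Lemma colour_perms_gt0 : (0 < #|colour_perms|)%N.
Proof.
by apply/card_gt0P; exists 1%g; apply/colour_permsP => x; rewrite perm1.
Qed.

Lemma colour_class_gt0 x : (0 < #|colour_class x|)%N.
Proof. by apply/card_gt0P; exists x; rewrite inE. Qed.

(** The points are treated one at a time: a transposition of two points of the
    same colour corrects the value at one more point. *)
Lemma extend_colour_perm (psi : X -> X) (D : seq X) :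
    {in D &, injective psi} -> {in D, forall y, c (psi y) = c y} ->
  exists2 g, g \in colour_perms & {in D, g =1 psi}.
Proof.
elim: D => [|a D IH] inj col.
  by exists 1%g => //; apply/colour_permsP => x; rewrite perm1.
have sub b : b \in D -> b \in a :: D by rewrite inE orbC => ->.
have [b b' /sub ? /sub ?|b /sub ?|g gG gE] := IH; [exact: inj|exact: col|].
exists (g * tperm (g a) (psi a))%g.
  apply/colour_permsP => x; rewrite permM; move/colour_permsP: gG => gc.
  have ca : c (psi a) = c a by rewrite col ?mem_head.
  by case: tpermP => [gx|gx|_ _]; rewrite ?ca -?(gc x) ?gx ?gc ?ca.
move=> b; rewrite inE permM; have [-> _|ba /= bD] := eqVneq b a.
  by rewrite tpermL.
rewrite tpermD; first exact: gE.
  by rewrite (inj_eq perm_inj) eq_sym.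
by rewrite gE //; apply: contra ba => /eqP /inj ->; rewrite ?mem_head ?sub.
Qed.

Variable x0 : X.

(** The maps of interest are defined on [Y] only; freezing the value at [x0]
    outside [Y] encodes them as maps on all of [X]. *)
Definition coloured_values (Y : {set X}) (v : X) : {set X} :=
  if v \in Y then colour_class v else [set x0].

Definition coloured_maps (Y : {set X}) :=
  family (fun v => mem (coloured_values Y v)).

Definition coloured_injections (Y : {set X}) : {set {ffun X -> X}} :=
  [set psi in coloured_maps Y | dinjectiveb psi (mem Y)].

Lemma coloured_mapsP Y (psi : {ffun X -> X}) :
  reflect ((forall y, y \in Y -> c (psi y) = c y) /\
           (forall y, y \notin Y -> psi y = x0)) (psi \in coloured_maps Y).
Proof.
apply: (iffP familyP) => [fam|[inY outY] v].
  by split=> y yY; have := fam y; rewrite /coloured_values ?yY ?(negPf yY) !inE => /eqP.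
rewrite /coloured_values /=; case: ifP => vY; first by rewrite inE inY.
by rewrite inE outY ?vY.
Qed.

Lemma card_coloured_maps Y :
  #|coloured_maps Y| = (\prod_(y in Y) #|colour_class y|)%N.
Proof.
rewrite card_family_prod [RHS]big_mkcond /=; apply: eq_bigr => v _.
by rewrite /coloured_values; case: ifP => _ //; rewrite cards1.
Qed.

Definition perm_restr (Y : {set X}) g : {ffun X -> X} :=
  [ffun v => if v \in Y then g v else x0].

Lemma perm_restr_coloured Y g :
  g \in colour_perms -> perm_restr Y g \in coloured_injections Y.
Proof.
move=> /colour_permsP cg; rewrite inE; apply/andP; split.
  by apply/coloured_mapsP; split=> y yY; rewrite ffunE ?yY ?(negPf yY) ?cg.
by apply/dinjectiveP => y z yY zY; rewrite !ffunE yY zY; apply: perm_inj.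
Qed.

Lemma perm_restr_onto Y psi : psi \in coloured_injections Y ->
  exists2 g, g \in colour_perms & perm_restr Y g = psi.
Proof.
rewrite inE => /andP[/coloured_mapsP[inY outY] /dinjectiveP inj].
have [b b'|b|g gG gE] := @extend_colour_perm psi (enum Y).
- by rewrite !mem_enum; apply: inj.
- by rewrite mem_enum; apply: inY.
exists g => //; apply/ffunP => v; rewrite ffunE.
by case: ifP => vY; [rewrite gE ?mem_enum|rewrite outY ?vY].
Qed.

(** A coloured map is the composite of a coloured injection and of a map from
    [Y] to itself: choose one representative in each fibre, and extend the map
    from the representatives to all of [Y] by a permutation. *)
Lemma card_coloured_maps_le Y :
  (#|coloured_maps Y| <= #|coloured_injections Y| * #|Y| ^ #|Y|)%N.
Proof.
pose codes := family (fun v => mem (if v \in Y then Y else [set v])).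
pose F (r : {ffun X -> X} * {ffun X -> X}) : {ffun X -> X} :=
  [ffun v => if v \in Y then r.1 (r.2 v) else x0].
have cardc : #|codes| = (#|Y| ^ #|Y|)%N.
  rewrite card_family_prod (eq_bigr (fun v => if v \in Y then #|Y| else 1%N)).
    by rewrite -big_mkcond /= prod_nat_const.
  by move=> v _; case: ifP => _ //; rewrite cards1.
have -> : (#|coloured_injections Y| * #|Y| ^ #|Y|)%N =
          #|finset.setX (coloured_injections Y) [set q in codes]|.
  by rewrite cardsX -cardc; congr (_ * _)%N; rewrite cardsE.
apply: leq_trans (leq_imset_card F _); rewrite -[X in (X <= _)%N]cardsE.
apply: subset_leq_card; apply/fintype.subsetP => psi; rewrite inE => psiM.
have [inY outY] := coloured_mapsP _ _ psiM.
(* [q v] is the representative of the fibre of [v] *)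
pose q : {ffun X -> X} :=
    [ffun v => if v \in Y then odflt v [pick y in Y | psi y == psi v] else v].
have qY v : v \in Y -> q v \in Y /\ psi (q v) = psi v.
  move=> vY; rewrite ffunE vY; case: pickP => [y /= /andP[-> /eqP]|/(_ v)] //=;
    by rewrite ?vY ?eqxx.
have qE v w : psi v = psi w -> v \in Y -> w \in Y -> q v = q w.
  move=> E vY wY; rewrite !ffunE vY wY (eq_pick (Q := [pred y in Y | psi y == psi w])).
    by case: pickP => // /(_ w) /=; rewrite wY eqxx.
  by move=> y /=; rewrite E.
have [b b'|b|g gG gE] := @extend_colour_perm psi [seq q y | y <- enum Y].
- move=> /mapP[v + ->] /mapP[w + ->]; rewrite !mem_enum => vY wY.
  by rewrite !(proj2 (qY _ _)) // => E; apply: qE.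
- by move=> /mapP[v + ->]; rewrite mem_enum => vY; apply/inY/(proj1 (qY _ vY)).
apply/imsetP; exists (perm_restr Y g, q).
  rewrite inE /= perm_restr_coloured // inE /=; apply/familyP => v.
  rewrite /=; case: ifP => vY; first exact: (proj1 (qY _ vY)).
  by rewrite ffunE vY set11.
apply/ffunP => v; rewrite [RHS]ffunE /=; case: ifP => vY; last by rewrite outY ?vY.
by have [q1 q2] := qY v vY; rewrite ffunE q1 gE ?q2 // map_f ?mem_enum.
Qed.

End ColouredPermutations.

(** * Averages over colour preserving permutations *)

Section OrbitAverage.
Variables (C : numClosedFieldType) (X Col : finType) (c : X -> Col) (x0 : X).
Variables (E : eqType) (k : E -> X -> X -> C) (s t : E -> X).
Implicit Types (es : seq E) (Y : {set X}) (psi : {ffun X -> X}).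

Definition endpoints es : {set X} :=
  [set x in map s es ++ map t es].

Definition edge_product es (psi : X -> X) : C :=
  \prod_(e <- es) k e (psi (s e)) (psi (t e)).

Lemma endpointsP es x :
  reflect (exists2 e, e \in es & x = s e \/ x = t e) (x \in endpoints es).
Proof.
rewrite inE mem_cat; apply: (iffP orP) => [[]/mapP[e ees ->]|[e ees [->|->]]].
- by exists e => //; left.
- by exists e => //; right.
- by left; apply: map_f.
- by right; apply: map_f.
Qed.

Lemma edge_product_ext es (psi psi' : X -> X) :
  {in endpoints es, psi =1 psi'} -> edge_product es psi = edge_product es psi'.
Proof.
move=> E1; apply: eq_big_seq => e ees.
have -> : psi (s e) = psi' (s e) by apply/E1/endpointsP; exists e => //; left.
have -> // : psi (t e) = psi' (t e) by apply/E1/endpointsP; exists e => //; right.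
Qed.

Lemma card_endpoints es : (#|endpoints es| <= (size es).*2)%N.
Proof.
rewrite cardsE; apply: leq_trans (card_size _) _.
by rewrite size_cat !size_map addnn.
Qed.

Definition distinct_pairs Y : seq (X * X) :=
  enum [set p in finset.setX Y Y | p.1 != p.2].

Lemma size_distinct_pairs Y : (size (distinct_pairs Y) <= #|Y| * #|Y|)%N.
Proof.
rewrite -cardE -cardsX; apply: subset_leq_card.
by apply/fintype.subsetP => p; rewrite inE => /andP[].
Qed.

Lemma prod_distinct_pairs Y psi :
  \prod_(p <- distinct_pairs Y) (1 - (psi p.1 == psi p.2)%:R) =
  (dinjectiveb psi (mem Y))%:R :> C.
Proof.
have [/dinjectiveP inj|/dinjectivePn[x xY [y]]] := boolP (dinjectiveb _ _).
  rewrite big1_seq // => p /andP[_]; rewrite mem_enum !inE => /andP[/andP[aY bY] ab].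
  by rewrite (negPf (contra_neq (inj _ _ aY bY) ab)) subr0.
rewrite !inE => /andP[yx yY] E1; rewrite (big_rem (x, y)) /=.
  by rewrite E1 eqxx subrr mul0r.
by rewrite mem_enum !inE /= xY yY eq_sym yx.
Qed.

Lemma sum_coloured_injections Y (f : {ffun X -> X} -> C) :
  \sum_(psi in coloured_injections c x0 Y) f psi =
  \sum_(psi in coloured_maps c x0 Y)
     \prod_(p <- distinct_pairs Y) (1 - (psi p.1 == psi p.2)%:R) * f psi.
Proof.
under [RHS]eq_bigr do rewrite prod_distinct_pairs.
rewrite [LHS](eq_bigl (fun psi => (psi \in coloured_maps c x0 Y)
    && dinjectiveb psi (mem Y))); last by move=> psi; rewrite inE.
rewrite big_mkcondr /=; apply: eq_bigr => psi _.
by case: ifP; rewrite ?mul1r ?mul0r.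
Qed.

(** Injectivity is removed by [graph_sum_distinct_le], and the vertices outside
    the endpoints of the edges are those frozen at [x0]. *)
Lemma coloured_injection_sum_le es :
    (forall e, e \in es -> contraction (k e)) ->
    (forall e, e \in es -> s e != t e) ->
  `|\sum_(psi in coloured_injections c x0 (endpoints es)) edge_product es psi| <=
  2 ^+ (#|endpoints es| * #|endpoints es|) *
  sqrtC (\prod_(y in endpoints es) #|colour_class c y|)%:R.
Proof.
move=> kc noloop; set Y := endpoints es.
have [S cross] := crossing_bipartition noloop.
have cover v : (#|coloured_values c x0 Y v| <= 1)%N \/
    exists e, [/\ e \in es, crossing s t S e & v = s e \/ v = t e].
  rewrite /coloured_values; case: ifP => vY; last by left; rewrite cards1.
  by right; have /endpointsP[e ees ve] := vY; apply: cross ees ve.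
have := graph_sum_distinct_le x0 (distinct_pairs Y) [::] kc cover.
rewrite -card_family_prod -[family _]/(coloured_maps c x0 Y) card_coloured_maps.
rewrite sum_coloured_injections => le1; apply: le_trans (le_trans _ le1) _.
  rewrite le_eqVlt; apply/orP; left; apply/eqP; congr (`|_|).
  by apply: eq_bigr => psi _; rewrite big_nil mulr1.
apply: ler_wpM2r; first by rewrite sqrtC_ge0.
by apply: ler_weXn2l; rewrite ?ler1n // size_distinct_pairs.
Qed.

(** The colour preserving permutations act transitively on the coloured
    injections of [Y], so that averaging over either gives the same result. *)
Lemma orbit_sum (es : seq E) :
  #|coloured_injections c x0 (endpoints es)|%:R *
    \sum_(g in colour_perms c) edge_product es g =
  #|colour_perms c|%:R *
    \sum_(psi in coloured_injections c x0 (endpoints es)) edge_product es psi.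
Proof.
set Y := endpoints es; set O := coloured_injections c x0 Y.
have avgE psi : psi \in O -> \sum_(g in colour_perms c) edge_product es (g \o psi)
    = \sum_(g in colour_perms c) edge_product es g.
  case/perm_restr_onto => h hG <-.
  rewrite [RHS](reindex_inj (mulgI h)) /=.
  apply: eq_big => [g|g gG].
    have /colour_permsP ch := hG.
    apply/colour_permsP/colour_permsP => cg x; first by rewrite permM cg ch.
    by rewrite -(permKV h x) -permM cg ch.
  by apply: edge_product_ext => y yY; rewrite /= ffunE yY permM.
(* sum over [psi] and [g] of the products along [g \o psi], in both orders *)
rewrite -sum1_card natr_sum mulr_suml.
rewrite (eq_bigr (fun psi => \sum_(g in colour_perms c) edge_product es (g \o psi)));
  last by move=> psi psiO; rewrite mul1r avgE.
rewrite exchange_big /= -sum1_card natr_sum mulr_suml; apply: eq_bigr => g gG.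
rewrite mul1r.
have inj : injective (fun psi : {ffun X -> X} =>
    [ffun v => if v \in Y then g (psi v) else psi v] : {ffun X -> X}).
  move=> psi psi' /ffunP E1; apply/ffunP => v; have := E1 v.
  by rewrite !ffunE; case: ifP => // _ /perm_inj.
rewrite [RHS](reindex_inj inj) /=; apply: eq_big => [psi|psi psiO].
  have /colour_permsP cg := gG; rewrite !inE; congr andb.
    apply/coloured_mapsP/coloured_mapsP => -[inY outY]; split=> y yY.
    - by rewrite ffunE yY cg inY.
    - by rewrite ffunE (negPf yY) outY.
    - by have := inY y yY; rewrite ffunE yY cg.
    - by have := outY y yY; rewrite ffunE (negPf yY).
  apply/dinjectiveP/dinjectiveP => inj' y z yY zY.
    by rewrite !ffunE yY zY => /perm_inj; apply: inj'.
  by move=> yz; apply: inj' => //; rewrite !ffunE yY zY yz.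
by apply: edge_product_ext => y yY; rewrite /= ffunE yY.
Qed.

(** The two factors bound the number of terms in the expansion of the injectivity
    constraint and the number of coloured maps per coloured injection, for at
    most [m] edges and hence at most [m.*2] endpoints. *)
Definition orbit_const (m : nat) : nat := (2 ^ (m.*2 * m.*2) * m.*2 ^ m.*2)%N.

(** Each point touched by the edges gains the factor [#|colour_class y|^-1/2]:
    the sum over the coloured injections is at most the square root of the
    number of coloured maps, and it is divided by the number of injections. *)
Lemma orbit_average_le (m : nat) es : (size es <= m)%N ->
    (forall e, e \in es -> contraction (k e)) ->
    (forall e x, e \in es -> k e x x = 0) ->
  `|\sum_(g in colour_perms c) edge_product es g| ^+ 2 *
     (\prod_(y in endpoints es) #|colour_class c y|)%:R <=
  (#|colour_perms c| * orbit_const m)%:R ^+ 2.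
Proof.
move=> sizem kc kdiag.
(* a loop carries a diagonal entry *)
have [/hasP[e ees /eqP ste]|/hasPn noloop] := boolP (has (fun e => s e == t e) es).
  rewrite big1 ?normr0 ?expr0n ?mul0r ?exprn_ge0 // => g _.
  by rewrite /edge_product (big_rem e) //= ste kdiag // mul0r.
have := coloured_injection_sum_le kc noloop; have := orbit_sum es.
set Y := endpoints es; set O := coloured_injections c x0 Y.
set W := (\prod_(y in Y) _)%N; set G := #|colour_perms c|.
set SG := \sum_(g in _) _; set SO := \sum_(psi in _) _ => GO leO.
have O0 : (0 < #|O|)%N.
  apply/card_gt0P; exists (perm_restr x0 Y 1%g); apply: perm_restr_coloured.
  by apply/colour_permsP => x; rewrite perm1.
have W_le : (W <= #|O| * #|Y| ^ #|Y|)%N.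
  by rewrite /W -(card_coloured_maps c x0); apply: card_coloured_maps_le.
have Ym : (#|Y| <= m.*2)%N.
  by apply: leq_trans (card_endpoints _) _; rewrite leq_double.
have YYm : (#|Y| ^ #|Y| <= m.*2 ^ m.*2)%N.
  have [->|Y0] := posnP #|Y|; first by rewrite expn0 expn_gt0; case: (m).
  apply: (@leq_trans (m.*2 ^ #|Y|)); first by rewrite leq_exp2r.
  by rewrite leq_pexp2l // (leq_trans Y0).
have leO2 : `|SO| ^+ 2 <= (2 ^ (m.*2 * m.*2))%:R ^+ 2 * W%:R.
  rewrite -(sqrtCK W%:R) -exprMn lerXn2r ?nnegrE ?mulr_ge0 ?sqrtC_ge0 //.
  apply: le_trans leO _; apply: ler_wpM2r; first by rewrite sqrtC_ge0.
  by rewrite -natrX ler_nat leq_pexp2l // leq_mul.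
rewrite -(ler_pM2l (_ : 0 < #|O|%:R ^+ 2)); last by rewrite exprn_gt0 ?ltr0n.
rewrite mulrA -exprMn -[#|O|%:R]ger0_norm // -normrM GO normrM exprMn !normr_nat.
apply: (@le_trans _ _ (G%:R ^+ 2 * ((2 ^ (m.*2 * m.*2))%:R ^+ 2 * W%:R) * W%:R)).
  by rewrite ler_wpM2r // ler_wpM2l // exprn_ge0.
have -> : G%:R ^+ 2 * ((2 ^ (m.*2 * m.*2))%:R ^+ 2 * W%:R) * W%:R =
  ((G * (2 ^ (m.*2 * m.*2)) * W)%N%:R : C) ^+ 2 by rewrite !natrM; ring.
rewrite -exprMn -natrM -!natrX ler_nat leq_sqr /orbit_const mulnCA -!mulnA.
rewrite leq_mul2l; apply/orP; right; rewrite mulnCA leq_mul2l; apply/orP; right.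
by apply: leq_trans W_le _; rewrite leq_mul2l YYm orbT.
Qed.

End OrbitAverage.

(** * Sums over paths *)

Lemma sum_tuple_cons (V : nmodType) (X : finType) (n : nat)
    (F : n.+1.-tuple X -> V) :
  \sum_t F t = \sum_x \sum_(t : n.-tuple X) F [tuple of x :: t].
Proof.
rewrite pair_bigA /= (reindex (fun r : X * n.-tuple X => [tuple of r.1 :: r.2])) //=.
exists (fun t => (thead t, [tuple of behead t])) => [[x t] _|t _] /=.
  by congr pair; apply: val_inj.
by rewrite -tuple_eta.
Qed.

Section Paths.
Variables (C : numClosedFieldType) (N : nat).

(** The entries of a product are sums over paths; [t] lists the vertices after
    the starting point [x]. *)
Lemma prod_mx_paths (n : nat) (B : 'I_n -> 'M[C]_N) (x0 x y : 'I_N) :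
  (\prod_(i < n) B i) x y =
  \sum_(t : n.-tuple 'I_N) (last x t == y)%:R *
     \prod_(i < n) B i (nth x0 (x :: t) i) (nth x0 t i).
Proof.
elim: n B x => [|n IH] B x.
  rewrite big_ord0 -[1]/(1%:M) mxE (big_pred1 [tuple]) => [|t].
    by rewrite big_ord0 mulr1.
  by rewrite [t]tuple0 /= eqxx.
rewrite big_ord_recl -[_ * _]/(_ *m _) mxE sum_tuple_cons; apply: eq_bigr => z _.
rewrite IH mulr_sumr; apply: eq_bigr => t _.
by rewrite big_ord_recl /=; ring.
Qed.

End Paths.

Section ColourSums.
Variables (C : numClosedFieldType) (X Col : finType) (c : X -> Col).
Implicit Types (Y : {set X}).

Definition class_weight Y : C := \prod_(y in Y) (#|colour_class c y|%:R)^-1.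

Lemma class_weight_ge0 Y : 0 <= class_weight Y.
Proof. by apply: prodr_ge0 => y _; rewrite invr_ge0. Qed.

(** Each colour that occurs contributes exactly [1] to the sum. *)
Lemma sum_class_inv_le : \sum_x (#|colour_class c x|%:R)^-1 <= #|Col|%:R :> C.
Proof.
rewrite (partition_big c predT) //= -sum1_card natr_sum; apply: ler_sum => a _.
case: (pickP (fun x => c x == a)) => [x0 /eqP cx0|none]; last by rewrite big_pred0.
rewrite (eq_bigr (fun=> (#|colour_class c x0|%:R)^-1)); last first.
  move=> x /eqP cx; congr (_%:R^-1); apply: eq_card => y; by rewrite !inE cx cx0.
rewrite -[leLHS]mul1r [1 * _]mulrC.
rewrite sumr_const mulr1 -[_ *+ _]mulr_natr.
rewrite (eq_card (B := colour_class c x0)); last first.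
  by move=> y; rewrite inE cx0.
by rewrite mulVf // pnatr_eq0 -lt0n colour_class_gt0.
Qed.

(** Either [x] is already in [Y], or it multiplies the weight by the inverse size
    of its class. *)
Lemma sum_class_weight_add Y :
  \sum_x class_weight (x |: Y) <= (#|Y| + #|Col|)%:R * class_weight Y.
Proof.
apply: (@le_trans _ _ (\sum_x ((x \in Y)%:R + (#|colour_class c x|%:R)^-1) *
    class_weight Y)).
  apply: ler_sum => x _; have [xY|xY] := boolP (x \in Y).
    rewrite (finset.setUidPr _) ?finset.sub1set // mulrDl mul1r lerDl.
    by rewrite mulr_ge0 ?invr_ge0 ?class_weight_ge0.
  by rewrite add0r /class_weight big_setU1.
rewrite -mulr_suml; apply: ler_wpM2r; first exact: class_weight_ge0.
rewrite big_split natrD lerD ?sum_class_inv_le //=.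
by rewrite -sum1_card natr_sum [leRHS]big_mkcond; apply: ler_sum => x _; case: ifP.
Qed.

(** The weight sees the set of the vertices of a path, so that a vertex visited
    several times counts once; this is why the points are added one by one. *)
Lemma sum_class_weight_tuple (D m : nat) Y : (#|Y| + m + #|Col| <= D)%N ->
  \sum_(t : m.-tuple X) class_weight ([set z in t] :|: Y) <=
  D%:R ^+ m * class_weight Y.
Proof.
elim: m Y => [|m IH] Y leD.
  rewrite (big_pred1 [tuple]) => [|t]; last by rewrite [t]tuple0 /= eqxx.
  rewrite expr0 mul1r (_ : _ :|: Y = Y) //.
  by apply/setP => z; rewrite !inE.
rewrite sum_tuple_cons.
apply: (@le_trans _ _ (\sum_x D%:R ^+ m * class_weight (x |: Y))).
  apply: ler_sum => x _.
  have := IH (x |: Y); rewrite (_ : (_ <= _)%N); last first.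
    apply: leq_trans leD; rewrite leq_add2r addnS -addSn leq_add2r cardsU1.
    by case: (_ \in _).
  move=> /(_ isT); apply: le_trans; rewrite le_eqVlt; apply/orP; left; apply/eqP.
  apply: eq_bigr => t _; congr class_weight; apply/setP => z.
  by rewrite !inE orbCA orbA.
rewrite -mulr_sumr exprSr -mulrA; apply: ler_wpM2l; first by rewrite exprn_ge0.
apply: le_trans (sum_class_weight_add Y) _.
apply: ler_wpM2r; first exact: class_weight_ge0.
by rewrite ler_nat; apply: leq_trans leD; rewrite leq_add2r leq_addr.
Qed.

End ColourSums.

(** * Alternating words in permuted matrices *)

Section Words.
Variables (C : numClosedFieldType) (N L n : nat) (Col : finType).
Variables (c : 'I_N -> Col) (l : 'I_n -> 'I_L) (B : 'I_n -> 'M[C]_N).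
Hypothesis n_gt0 : (0 < n)%N.
Hypothesis l_neq : forall i j : 'I_n, j = i.+1 :> nat -> l i <> l j.
Hypothesis B_contr : forall i, contraction (B i).
Hypothesis B_diag : forall i x, B i x x = 0.

Definition perm_conj (s : {perm 'I_N}) (A : 'M[C]_N) : 'M[C]_N :=
  \matrix_(x, y) A (s x) (s y).

(** An edge is a position in the word, with a boolean that tells the word from
    its conjugate: the squared modulus of an entry is a sum over pairs of paths. *)
Definition word_kernel (e : bool * 'I_n) (x y : 'I_N) : C :=
  if e.1 then B e.2 x y else (B e.2 x y)^*.

Definition word_edges (a : 'I_L) : seq (bool * 'I_n) :=
  [seq e <- enum {: bool * 'I_n} | l e.2 == a].

Section ClosedPaths.
Variables (x : 'I_N) (t t' : n.-tuple 'I_N).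
Hypotheses (t_closed : last x t = x) (t'_closed : last x t' = x).

Definition path_of (b : bool) : seq 'I_N := if b then t else t'.
Definition path_source (e : bool * 'I_n) := nth x (x :: path_of e.1) e.2.
Definition path_target (e : bool * 'I_n) := nth x (path_of e.1) e.2.

Notation Y := ([set z in t] :|: ([set z in t'] :|: [set x])).
Notation Yl a := (endpoints path_source path_target (word_edges a)).
Notation f y := #|colour_class c y|.

Lemma size_path b : size (path_of b) = n.
Proof. by case: b; rewrite size_tuple. Qed.

Lemma mem_word_edges a e : (e \in word_edges a) = (l e.2 == a).
Proof. by rewrite mem_filter mem_enum andbT. Qed.

Lemma mem_path_set b z : z \in x :: path_of b -> z \in Y.
Proof.
by rewrite !inE; case: b => /orP[] ->; rewrite ?orbT.
Qed.

Lemma endpoints_sub a : Yl a \subset Y.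
Proof.
apply/fintype.subsetP => z /endpointsP[e _ ze]; apply: (@mem_path_set e.1).
case: ze => ->; first by rewrite mem_nth //= size_path ltnS ltnW.
by rewrite inE mem_nth ?orbT // size_path.
Qed.

(** A vertex of a closed path other than the base point [x] lies between two
    consecutive edges, whose matrices belong to different families. *)
Lemma vertex_multiplicity y : y \in Y ->
  ((y != x).+1 <= #|[set a | y \in Yl a]|)%N.
Proof.
move=> yY; have [->|yx] := eqVneq y x.
  apply/card_gt0P; exists (l (Ordinal n_gt0)); rewrite inE.
  apply/endpointsP; exists (true, Ordinal n_gt0); first by rewrite mem_word_edges.
  by left.
have [b yb] : exists b, y \in path_of b.
  by move: yY; rewrite !inE (negPf yx) orbF => /orP[yt|yt]; [exists true|exists false].
set j := index y (path_of b); have jn : (j < n)%N by rewrite -(size_path b) index_mem.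
have yj : nth x (path_of b) j = y by apply: nth_index.
have jn1 : (j.+1 < n)%N.
  rewrite ltn_neqAle jn andbT; apply: contraNneq yx => jn1.
  rewrite -yj -[j]/(j.+1.-1) jn1 -(size_path b) nth_last.
  by case: (b) => /=; rewrite ?t_closed ?t'_closed.
apply/card_gt1P; exists (l (Ordinal jn)), (l (Ordinal jn1)); split.
- rewrite inE; apply/endpointsP; exists (b, Ordinal jn); rewrite ?mem_word_edges //.
  by right.
- rewrite inE; apply/endpointsP; exists (b, Ordinal jn1); rewrite ?mem_word_edges //.
  by left.
by apply/eqP; apply: l_neq.
Qed.

(** The base point may be touched by a single family; the factor [N] makes up for
    the missing one. *)
Lemma prod_class_sizes_le :
  ((\prod_(y in Y) f y) ^ 2 <= N * \prod_a \prod_(y in Yl a) f y)%N.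
Proof.
have -> : (\prod_a \prod_(y in Yl a) f y =
    \prod_(y in Y) f y ^ #|[set a | y \in Yl a]|)%N.
  rewrite (exchange_big_dep (mem Y)) /=; last first.
    by move=> a y _; apply: (fintype.subsetP (endpoints_sub a)).
  apply: eq_bigr => y _; rewrite prod_nat_const; congr (_ ^ _)%N.
  by apply: eq_card => a; rewrite [RHS]inE.
have xY : x \in Y by rewrite !inE eqxx !orbT.
have fN : (f x <= N)%N by rewrite -[leqRHS]card_ord max_card.
rewrite (bigD1 x) //= [X in (_ <= _ * X)%N](bigD1 x) //= expnMn mulnA.
apply: leq_mul.
  rewrite expnS expn1; apply: leq_mul => //.
  rewrite -[leqLHS]expn1 leq_pexp2l ?colour_class_gt0 //.
  by have := vertex_multiplicity xY; rewrite eqxx.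
rewrite (big_morph (fun a => a ^ 2)%N (fun a b => expnMn a b 2) (exp1n 2)).
apply: leq_prod => y /andP[yY yx].
rewrite leq_pexp2l ?colour_class_gt0 //.
by have := vertex_multiplicity yY; rewrite yx.
Qed.

(** The families contribute their bounds [orbit_average_le] independently, and
    [prod_class_sizes_le] collects the gains of all the vertices. *)
Lemma closed_path_average_le :
  `|\prod_a \sum_(g in colour_perms c)
      edge_product word_kernel path_source path_target (word_edges a) g| <=
  sqrtC N%:R * (#|colour_perms c| * orbit_const n.*2)%:R ^+ L * class_weight C c Y.
Proof.
set z := `|_|; set G := #|_|; set K := orbit_const _.
have zle : z ^+ 2 * (\prod_a \prod_(y in Yl a) f y)%:R <= ((G * K)%:R ^+ L) ^+ 2.
  rewrite /z normr_prod -prodrXl natr_prod -big_split /= exprAC.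
  rewrite -[X in _ <= _ ^+ X]card_ord -prodr_const.
  apply: ler_prod => a _; rewrite mulr_ge0 ?exprn_ge0 //=.
  apply: (orbit_average_le c x).
  - rewrite size_filter (leq_trans (count_size _ _)) // -cardE card_prod card_bool.
    by rewrite card_ord mul2n.
  - move=> [[] i] _; rewrite /word_kernel /=; first exact: B_contr.
    exact/sqbounded_conj/B_contr.
  - by move=> [[] i] y _; rewrite /word_kernel /= B_diag ?rmorph0.
set P := (\prod_(y in Y) f y)%N.
have P0 : 0 < P%:R :> C.
  by rewrite ltr0n prodn_gt0 // => y; exact: colour_class_gt0.
have -> : class_weight C c Y = P%:R^-1.
  by rewrite /class_weight /P natr_prod prodfV.
rewrite ler_pdivlMr //.
rewrite -ler_sqr ?nnegrE ?mulr_ge0 ?sqrtC_ge0 ?exprn_ge0 ?(ltW P0) //; last exact: normr_ge0.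
rewrite !exprMn sqrtCK.
apply: (@le_trans _ _ (N%:R * (z ^+ 2 * (\prod_a \prod_(y in Yl a) f y)%:R))).
  rewrite [leRHS]mulrCA ler_wpM2l ?exprn_ge0 ?normr_ge0 //.
  by rewrite -natrX -natrM ler_nat prod_class_sizes_le.
by rewrite ler_wpM2l.
Qed.

End ClosedPaths.

(** The second factor bounds the sum of the weights of the pairs of paths, which
    have [n.*2.+1] vertices, the base point counted once. *)
Definition word_const : nat :=
  (orbit_const n.*2 ^ L * (n.*2.+1 + #|Col|) ^ n.*2.+1)%N.

Notation families := (ffun_on (mem (colour_perms c))).

Lemma sqnorm_word_diag (g : {ffun 'I_L -> {perm 'I_N}}) x :
  `|(\prod_(i < n) perm_conj (g (l i)) (B i)) x x| ^+ 2 =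
  \sum_(t : n.-tuple 'I_N) \sum_(t' : n.-tuple 'I_N)
    ((last x t == x) && (last x t' == x))%:R *
    \prod_a edge_product word_kernel (path_source x t t') (path_target x t t')
       (word_edges a) (g a).
Proof.
rewrite normCK (prod_mx_paths _ x) rmorph_sum mulr_suml; apply: eq_bigr => t _ /=.
rewrite mulr_sumr; apply: eq_bigr => t' _.
rewrite rmorphM /= conjC_nat mulrACA -natrM mulnb; congr (_ * _).
rewrite rmorph_prod /=.
have -> : \prod_a edge_product word_kernel (path_source x t t') (path_target x t t')
       (word_edges a) (g a) =
   \prod_(e : bool * 'I_n) word_kernel e (g (l e.2) (path_source x t t' e))
       (g (l e.2) (path_target x t t' e)).
  rewrite (partition_big (fun e : bool * 'I_n => l e.2) predT) //=.
  apply: eq_bigr => a _; rewrite /edge_product big_filter big_enum_cond /=.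
  by apply: eq_bigr => e /eqP ->.
rewrite -(pair_bigA _ (fun b i => word_kernel (b, i) (g (l i) (path_source x t t' (b, i)))
       (g (l i) (path_target x t t' (b, i))))) /=.
rewrite big_bool /=.
by congr (_ * _); apply: eq_bigr => i _; rewrite mxE.
Qed.

(** The colour preserving permutations of the different families are averaged
    independently, so the average of a product over a pair of closed paths is
    the product of the averages; the latter are bounded one path at a time. *)
Theorem word_average_le :
  \sum_(g in families) \sum_x
     `|(\prod_(i < n) perm_conj (g (l i)) (B i)) x x| ^+ 2 <=
  sqrtC N%:R * (#|colour_perms c| ^ L)%:R * word_const%:R.
Proof.
set S := \sum_(g in _) _; have S0 : 0 <= S.
  by apply: sumr_ge0 => g _; apply: sumr_ge0 => x _; rewrite exprn_ge0.
set K := orbit_const n.*2; set G := #|colour_perms c|.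
pose Y x (t t' : n.-tuple 'I_N) : {set 'I_N} := [set z in t] :|: ([set z in t'] :|: [set x]).
have SE : S = \sum_x \sum_(t : n.-tuple 'I_N) \sum_(t' : n.-tuple 'I_N)
    ((last x t == x) && (last x t' == x))%:R *
    \prod_a \sum_(g in colour_perms c) edge_product word_kernel
      (path_source x t t') (path_target x t t') (word_edges a) g.
  rewrite /S exchange_big; apply: eq_bigr => x _ /=.
  under eq_bigr do rewrite sqnorm_word_diag.
  rewrite exchange_big; apply: eq_bigr => t _ /=.
  rewrite exchange_big; apply: eq_bigr => t' _ /=.
  by rewrite -mulr_sumr bigA_distr_big.
(* single pairs of paths give complex numbers, but their sum is nonnegative *)
rewrite -(ger0_norm S0) SE {S S0 SE}.
apply: (@le_trans _ _ (\sum_x \sum_(t : n.-tuple 'I_N) \sum_(t' : n.-tuple 'I_N)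
   (sqrtC N%:R * (G * K)%:R ^+ L * class_weight C c (Y x t t')))).
  apply: le_trans (ler_norm_sum _ _ _) _; apply: ler_sum => x _.
  apply: le_trans (ler_norm_sum _ _ _) _; apply: ler_sum => t _.
  apply: le_trans (ler_norm_sum _ _ _) _; apply: ler_sum => t' _.
  have [/andP[/eqP tc /eqP tc']|_] := boolP (_ && _); last first.
    rewrite mul0r normr0; apply: mulr_ge0; last exact: class_weight_ge0.
    by rewrite mulr_ge0 ?sqrtC_ge0 ?exprn_ge0.
  by rewrite mul1r; apply: closed_path_average_le.
under eq_bigr do (under eq_bigr do rewrite -mulr_sumr; rewrite -mulr_sumr).
rewrite -mulr_sumr /word_const -/K; move: (K) => K0.
rewrite !natrM !natrX exprMn.
rewrite -!mulrA ler_wpM2l ?sqrtC_ge0 // ler_wpM2l ?exprn_ge0 // ler_wpM2l ?exprn_ge0 //.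
set D := (n.*2.+1 + #|Col|)%N.
apply: (@le_trans _ _ (\sum_x \sum_(t : n.-tuple 'I_N)
   D%:R ^+ n * class_weight C c ([set z in t] :|: [set x]))).
  apply: ler_sum => x _; apply: ler_sum => t _.
  rewrite (eq_bigr (fun t' : n.-tuple 'I_N => class_weight C c
    ([set z in t'] :|: ([set z in t] :|: [set x])))); last first.
    by move=> t' _; rewrite /Y finset.setUCA.
  apply: sum_class_weight_tuple; rewrite leq_add2r.
  rewrite -addnn -addSn leq_add2r; apply: leq_trans (leq_card_setU _ _) _.
  rewrite cards1 addn1 ltnS cardsE; apply: leq_trans (card_size _) _.
  by rewrite size_tuple.
under eq_bigr do rewrite -mulr_sumr.
rewrite -mulr_sumr.
apply: (@le_trans _ _ (D%:R ^+ n * \sum_x D%:R ^+ n * class_weight C c (x |: finset.set0))).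
  rewrite ler_wpM2l ?exprn_ge0 //; apply: ler_sum => x _; rewrite finset.setU0.
  apply: sum_class_weight_tuple; rewrite cards1 leq_add2r add1n.
  by rewrite ltnS -addnn leq_addr.
rewrite -mulr_sumr mulrA -exprD addnn exprSr ler_wpM2l ?exprn_ge0 //.
apply: le_trans (sum_class_weight_add _ _ _) _.
by rewrite cards0 add0n /class_weight big_set0 mulr1 ler_nat leq_addl.
Qed.

End Words.

(** * Perturbation of products of bounded matrices *)

Section BoundedMatrices.
Variables (C : numClosedFieldType) (N : nat).
Implicit Types (A B : 'M[C]_N) (c d : C).

Lemma sqbounded_le c d A : c <= d -> sqbounded c A -> sqbounded d A.
Proof.
move=> cd Ac w; apply: le_trans (Ac w) _.
by apply: ler_wpM2r => //; apply: sqnorm_ge0.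
Qed.

Lemma sqbounded0 c : 0 <= c -> sqbounded c (0 : 'M[C]_N).
Proof.
move=> c0 w; rewrite /sqnorm big1 ?mulr_ge0 ?sqnorm_ge0 // => x _.
by rewrite big1 ?normr0 ?expr0n // => y _; rewrite mxE mul0r.
Qed.

Lemma sqbounded1 : contraction (1 : 'M[C]_N).
Proof.
move=> w; have := @contraction_id C _ w; congr (_ <= _).
by apply: eq_bigr => x _; congr (`|_| ^+ 2); apply: eq_bigr => y _; rewrite mxE.
Qed.

Lemma sqbounded_mul c d A B : 0 <= c ->
  sqbounded c A -> sqbounded d B -> sqbounded (c * d) (A * B).
Proof.
move=> c0 Ac Bd w; apply: (@le_trans _ _ (c * sqnorm (fun y => \sum_z B y z * w z))).
  have := Ac (fun y => \sum_z B y z * w z); congr (_ <= _).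
  apply: eq_bigr => x _; congr (`|_| ^+ 2).
  under [RHS]eq_bigr do rewrite mxE mulr_suml.
  rewrite exchange_big; apply: eq_bigr => y _ /=.
  by rewrite mulr_sumr; apply: eq_bigr => z _; rewrite mulrA.
by rewrite -mulrA ler_wpM2l.
Qed.

Lemma sqbounded_scale c a A : sqbounded c A -> sqbounded (`|a| ^+ 2 * c) (a *: A).
Proof.
move=> Ac w; rewrite -mulrA.
apply: (@le_trans _ _ (`|a| ^+ 2 * sqnorm (fun x => \sum_y A x y * w y))).
  rewrite mulr_sumr le_eqVlt; apply/orP; left; apply/eqP; apply: eq_bigr => x _.
  rewrite -exprMn -normrM mulr_sumr; congr (`|_| ^+ 2).
  by apply: eq_bigr => y _; rewrite mxE mulrA.
by rewrite ler_wpM2l ?exprn_ge0.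
Qed.

(** Squared norms are only almost subadditive; the factor [2] replaces the
    triangle inequality. *)
Lemma sqbounded_sub c d A B :
  sqbounded c A -> sqbounded d B -> sqbounded (2 * (c + d)) (A - B).
Proof.
move=> Ac Bd w; set a := fun x => \sum_y A x y * w y; set b := fun x => \sum_y B x y * w y.
apply: (@le_trans _ _ (2 * (sqnorm a + sqnorm b))); last first.
  by rewrite -mulrA ler_wpM2l // mulrDl lerD ?Ac ?Bd.
rewrite mulrDr !mulr_sumr -big_split /=; apply: ler_sum => x _.
have -> : \sum_y (A - B) x y * w y = a x - b x.
  by rewrite -sumrB; apply: eq_bigr => y _; rewrite !mxE mulrBl.
(* the parallelogram identity *)
rewrite -subr_ge0 (_ : _ - _ = `|a x + b x| ^+ 2) ?exprn_ge0 //.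
by rewrite !normCK rmorphB (rmorphD _ (a x)) /=; ring.
Qed.

Lemma sqbounded_diag c (b : 'rV[C]_N) :
  (forall x, `|b 0 x| ^+ 2 <= c) -> sqbounded c (diag_mx b).
Proof.
move=> bc w; rewrite mulr_sumr; apply: ler_sum => x _.
rewrite (bigD1 x) //= !mxE eqxx mulr1n big1 ?addr0; last first.
  by move=> y; rewrite eq_sym !mxE => /negPf ->; rewrite mulr0n mul0r.
by rewrite normrM exprMn ler_wpM2r ?exprn_ge0.
Qed.

Lemma sqbounded_perm_conj c (s : {perm 'I_N}) A :
  sqbounded c A -> sqbounded c (perm_conj s A).
Proof.
move=> Ac w; have := Ac (fun y => w ((s^-1)%g y)); rewrite /sqnorm => le1.
rewrite (reindex_perm (s^-1)%g) /= [in leRHS](reindex_perm (s^-1)%g) /=.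
move: le1; congr (_ <= _); apply: eq_bigr => x _; congr (`|_| ^+ 2).
rewrite [RHS](reindex_perm (s^-1)%g) /=; apply: eq_bigr => y _.
by rewrite mxE !permKV.
Qed.

(** Telescoping: in a product of bounded factors, replacing each factor by a
    close one changes the product little. *)
Lemma sqbounded_prod_perturb c d (r : seq ('M[C]_N * 'M[C]_N)) : 1 <= c -> 0 <= d ->
    (forall q, q \in r -> [/\ sqbounded c q.1, sqbounded c q.2 &
       sqbounded d (q.1 - q.2)]) ->
  [/\ sqbounded (c ^+ size r) (\prod_(q <- r) q.1),
      sqbounded (c ^+ size r) (\prod_(q <- r) q.2) &
      sqbounded (d * (4 * c) ^+ size r) (\prod_(q <- r) q.1 - \prod_(q <- r) q.2)].
Proof.
move=> c1 d0; have c0 : 0 <= c by apply: le_trans c1.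
elim: r => [|q r IH] rc.
  rewrite !big_nil expr0 subrr mulr1; split; [exact: sqbounded1..|exact: sqbounded0].
have [|IH1 IH2 IH3] := IH; first by move=> q' q'r; apply: rc; rewrite inE q'r orbT.
have [q1 q2 q3] := rc _ (mem_head _ _).
rewrite !big_cons /= !exprS.
split; [exact: (sqbounded_mul c0 q1 IH1)|exact: (sqbounded_mul c0 q2 IH2)|].
have -> : q.1 * \prod_(j <- r) j.1 - q.2 * \prod_(j <- r) j.2 =
  (q.1 - q.2) * \prod_(j <- r) j.1 -
  q.2 * (- (\prod_(j <- r) j.1 - \prod_(j <- r) j.2)).
  by rewrite mulrN opprK mulrBr mulrBl addrA subrK.
have sN A e : sqbounded e A -> sqbounded e (- A).
  by move=> /(sqbounded_scale (-1)); rewrite normrN1 expr1n mul1r scaleN1r.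
apply: sqbounded_le (sqbounded_sub (sqbounded_mul d0 q3 IH1)
  (sqbounded_mul c0 q2 (sN _ _ IH3))).
have cX : 0 <= c ^+ size r by rewrite exprn_ge0.
have le1 : c ^+ size r <= (4 * c) ^+ size r.
  by rewrite exprMn ler_peMl // exprn_ege1 // ler1n.
rewrite (_ : d * (4 * c * _) = 2 * (d * (c * (4 * c) ^+ size r) + c * (d * (4 * c) ^+ size r)));
  last by ring.
rewrite ler_wpM2l // lerD2r ler_wpM2l //; apply: le_trans le1 _.
by rewrite ler_peMl // exprn_ge0 // mulr_ge0.
Qed.

End BoundedMatrices.

(** * Operator norms and rounding of complex numbers *)

Local Open Scope complex_scope.

Section OperatorNorm.
Variables (R : realType) (N : nat).
Implicit Types (A : 'M[R[i]]_N) (v : 'cV[R[i]]_N).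

Lemma sqnorm_enorm v : sqnorm (fun x => v x 0) = (enorm v ^+ 2)%:C.
Proof.
rewrite /enorm sqr_sqrtr; last by apply: sumr_ge0 => x _; rewrite sqr_ge0.
by rewrite rmorph_sum; apply: eq_bigr => x _; rewrite rmorphXn.
Qed.

Lemma sqnorm_mulmx A v :
  sqnorm (fun x => \sum_y A x y * v y 0) = (enorm (A *m v) ^+ 2)%:C.
Proof.
by rewrite -sqnorm_enorm; apply: eq_bigr => x _; rewrite mxE.
Qed.

(** The Frobenius norm is an upper bound; without a bound the supremum that
    defines the operator norm would be meaningless. *)
Lemma has_ubound_opnorm A :
  has_ubound [set enorm (A *m v) | v in [set v | enorm v <= 1]]%classic.
Proof.
pose S := \sum_x \sum_y Normc.normc (A x y) ^+ 2.
have S0 : 0 <= S.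
  by apply: sumr_ge0 => x _; apply: sumr_ge0 => y _; rewrite sqr_ge0.
exists (Num.sqrt S) => _ [v /= v1 <-].
rewrite -[leLHS]ger0_norm ?sqrtr_ge0 // -sqrtr_sqr ler_sqrt //.
rewrite -lecR -sqnorm_mulmx /sqnorm.
have -> : S%:C = \sum_x \sum_y `|A x y| ^+ 2.
  rewrite rmorph_sum; apply: eq_bigr => x _; rewrite rmorph_sum.
  by apply: eq_bigr => y _; rewrite rmorphXn.
apply: ler_sum => x _; apply: le_trans (cauchy_schwarz _ _ _) _.
rewrite -[leRHS]mulr1 ler_wpM2l //.
  by apply: sumr_ge0 => y _; rewrite exprn_ge0.
rewrite -[leLHS]/(sqnorm (fun y => v y 0)) sqnorm_enorm lecR.
by rewrite expr_le1 // sqrtr_ge0.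
Qed.

Lemma opnorm_sqbounded A (r : R) : opnorm A <= r -> sqbounded (r ^+ 2)%:C A.
Proof.
move=> Ar w; pose v : 'cV[R[i]]_N := \col_x w x.
have wE : sqnorm w = (enorm v ^+ 2)%:C.
  by rewrite -sqnorm_enorm; apply: eq_bigr => x _; rewrite mxE.
have -> : sqnorm (fun x => \sum_y A x y * w y) = (enorm (A *m v) ^+ 2)%:C.
  rewrite -sqnorm_mulmx; apply: eq_bigr => x _; congr (`|_| ^+ 2).
  by apply: eq_bigr => y _; rewrite mxE.
rewrite wE -rmorphM lecR -exprMn.
have enorm_ge0 (u : 'cV[R[i]]_N) : 0 <= enorm u by apply: sqrtr_ge0.
have enormZ (a : R) (u : 'cV[R[i]]_N) : 0 <= a -> enorm (a%:C *: u) = a * enorm u.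
  move=> a0; apply/eqP; rewrite -(eqrXn2 (n := 2)) ?mulr_ge0 //; apply/eqP.
  apply: complexI; rewrite -sqnorm_enorm exprMn rmorphM /= -sqnorm_enorm.
  rewrite /sqnorm mulr_sumr; apply: eq_bigr => x _; rewrite mxE normrM exprMn.
  by rewrite rmorphXn /= ger0_norm // ler0c.
have ub u : enorm u <= 1 -> enorm (A *m u) <= r.
  move=> u1; apply: le_trans Ar; apply: ub_le_sup; first exact: has_ubound_opnorm.
  by exists u.
have r0 : 0 <= r.
  apply: le_trans (enorm_ge0 (A *m 0)) (ub 0 _).
  by have := enormZ 0 0 (lexx _); rewrite scaler0 mul0r => ->.
rewrite ler_sqr ?nnegrE ?mulr_ge0 //.
have [v0|v0] := eqVneq (enorm v) 0.
  have -> : v = 0.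
    apply/matrixP => x y; rewrite ord1 [RHS]mxE.
    have /eqP : sqnorm (fun x => v x 0) = 0 by rewrite sqnorm_enorm v0 expr0n.
    rewrite psumr_eq0 => [/allP/(_ x)|z _]; last by rewrite exprn_ge0.
    by rewrite mem_index_enum => /(_ isT) /=; rewrite sqrf_eq0 normr_eq0 => /eqP.
  by rewrite mulmx0 -[0](scaler0 _ 0%:C) enormZ // mul0r mulr_ge0.
have vp : 0 < enorm v by rewrite lt0r v0 enorm_ge0.
have := ub ((enorm v)^-1%:C *: v); rewrite -scalemxAr !enormZ ?invr_ge0 //.
by rewrite mulVf // => /(_ (lexx _)); rewrite mulrC ler_pdivrMr.
Qed.

End OperatorNorm.

Section Quantisation.
Variable R : realType.

(** Cut the interval [-b, b] into pieces of length [d]. *)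
Lemma quantise_real (b d : R) : 0 < d -> exists (Q : nat) (q : R -> 'I_Q.+1),
  forall x y, `|x| <= b -> `|y| <= b -> q x = q y -> `|x - y| <= d.
Proof.
move=> d0; exists (Num.truncn ((b + b) / d)).
exists (fun x => inord (Num.truncn ((x + b) / d))) => x y xb yb.
have lem z : `|z| <= b -> 0 <= (z + b) / d /\
    (Num.truncn ((z + b) / d) < (Num.truncn ((b + b) / d)).+1)%N.
  rewrite ler_norml => /andP[z1 z2]; split.
    by rewrite divr_ge0 ?(ltW d0) // -lerBlDr sub0r.
  by rewrite ltnS; apply: le_truncn; rewrite ler_wpM2r ?invr_ge0 ?(ltW d0) // lerD2r.
have [x0 x1] := lem _ xb; have [y0 y1] := lem _ yb.
move=> /(congr1 val); rewrite /= !inordK // => E.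
have /andP[x2 x3] := truncn_itv x0; have /andP[y2 y3] := truncn_itv y0.
rewrite E in x2 x3.
have -> : x - y = d * ((x + b) / d - (y + b) / d).
  by field; rewrite gt_eqF.
rewrite normrM gtr0_norm // ger_pMr //.
rewrite -natr1 in x3 y3.
by rewrite ler_norml; apply/andP; split; lra.
Qed.

Lemma quantise (c d : R) : 0 < d -> exists (Q : finType) (q : R[i] -> Q),
  forall z z', `|z| ^+ 2 <= c%:C -> `|z'| ^+ 2 <= c%:C -> q z = q z' ->
    `|z - z'| ^+ 2 <= d%:C.
Proof.
(* then [2 * e ^+ 2 <= d], and [1 + c] bounds the square root of [c] *)
move=> d0; pose e := Num.min 1 d / 2.
have e0 : 0 < e by rewrite divr_gt0 // lt_min ltr01.
have [Q [q qE]] := quantise_real (1 + c) e0.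
exists ('I_Q.+1 * 'I_Q.+1)%type, (fun z => (q (complex.Re z), q (complex.Im z))).
have bnd z : `|z| ^+ 2 <= c%:C ->
    `|complex.Re z| <= 1 + c /\ `|complex.Im z| <= 1 + c.
  rewrite -add_Re2_Im2 lecR => zc.
  by split; rewrite ler_norml; apply/andP; split; nra.
move=> z z' /bnd[zr zi] /bnd[zr' zi'] [/(qE _ _ zr zr') er /(qE _ _ zi zi') ei].
rewrite -add_Re2_Im2 lecR !raddfB /=.
have e1 : 2 * e <= 1 by rewrite mulrC divfK // ge_min lexx.
have e2 : 2 * e <= d by rewrite mulrC divfK // ge_min lexx orbT.
move: er ei; rewrite !ler_norml => /andP[] + + /andP[].
set u := (_ - _); set v := (_ - _) => *; nra.
Qed.

End Quantisation.

(** * Centred monomials and rounding of coefficients *)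

Section Centring.
Variables (R : realType) (N : nat).
Implicit Types (A B : 'M[R[i]]_N) (c : R[i]).

Definition centred A : 'M[R[i]]_N := A - diag_part A.

Lemma diag_part_diag_mx A : diag_part A = diag_mx (\row_x A x x).
Proof.
apply/matrixP => x y; rewrite !mxE; have [->|_] := eqVneq x y.
  by rewrite mul1r mulr1n.
by rewrite mul0r mulr0n.
Qed.

Lemma sqbounded_diag_part c A : sqbounded c A -> sqbounded c (diag_part A).
Proof.
move=> Ac; rewrite diag_part_diag_mx; apply: sqbounded_diag => x; rewrite mxE.
exact: (sqbounded_entry Ac).
Qed.

Lemma sqbounded_centred c A : sqbounded c A -> sqbounded (4 * c) (centred A).
Proof.
move=> Ac; apply: sqbounded_le (sqbounded_sub Ac (sqbounded_diag_part Ac)).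
by rewrite le_eqVlt; apply/orP; left; apply/eqP; ring.
Qed.

Lemma centredB A B : centred A - centred B = centred (A - B).
Proof. by apply/matrixP => x y; rewrite !mxE; ring. Qed.

Lemma centred_diag A x : centred A x x = 0.
Proof. by rewrite !mxE eqxx mul1r subrr. Qed.

Lemma centred_perm_conj (s : {perm 'I_N}) A :
  centred (perm_conj s A) = perm_conj s (centred A).
Proof. by apply/matrixP => x y; rewrite !mxE (inj_eq perm_inj). Qed.

Lemma perm_conjM (s : {perm 'I_N}) A B :
  perm_conj s (A * B) = perm_conj s A * perm_conj s B.
Proof.
apply/matrixP => x y; rewrite !mxE [LHS](reindex_perm s) /=.
by apply: eq_bigr => z _; rewrite !mxE.
Qed.

Lemma perm_conj1 (s : {perm 'I_N}) : perm_conj s (1 : 'M[R[i]]_N) = 1.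
Proof. by apply/matrixP => x y; rewrite !mxE (inj_eq perm_inj). Qed.

Lemma perm_conj_prod (s : {perm 'I_N}) (I : Type) (r : seq I) (F : I -> 'M[R[i]]_N) :
  perm_conj s (\prod_(j <- r) F j) = \prod_(j <- r) perm_conj s (F j).
Proof. exact: (big_morph (perm_conj s) (perm_conjM s) (perm_conj1 s)). Qed.

End Centring.

Section Coefficients.
Variables (R : realType) (K : Type) (N : nat).
Implicit Types (Q : monomial R K N) (f : 'rV[R[i]]_N -> 'rV[R[i]]_N).

Definition coefs Q : seq 'rV[R[i]]_N := mon_head Q :: [seq kb.2 | kb <- mon_tail Q].

Definition map_coefs f Q : monomial R K N :=
  Monomial (f (mon_head Q)) [seq (kb.1, f kb.2) | kb <- mon_tail Q].

(** Between two coefficients there is one random matrix, so that a factor of the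
    telescoped product is a matrix times a coefficient, of bound [c * c].  The
    final bound is linear in [d], which makes the cost of rounding as small as
    desired. *)
Lemma mon_eval_perturb (c d : R[i]) D f (a : K -> 'M[R[i]]_N) Q : 1 <= c -> 0 <= d ->
    (mon_degree Q <= D)%N -> (forall k, sqbounded c (a k)) ->
    (forall b, b \in coefs Q -> [/\ sqbounded c (diag_mx b), sqbounded c (diag_mx (f b)) &
       sqbounded d (diag_mx b - diag_mx (f b))]) ->
  [/\ sqbounded ((c * c) ^+ D.+1) (mon_eval Q a),
      sqbounded ((c * c) ^+ D.+1) (mon_eval (map_coefs f Q) a) &
      sqbounded (c * d * (4 * (c * c)) ^+ D.+1)
        (mon_eval Q a - mon_eval (map_coefs f Q) a)].
Proof.
move=> c1 d0 QD ac bc; have c0 : 0 <= c by apply: le_trans c1.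
have cc1 : 1 <= c * c by rewrite mulr_ege1.
have cd0 : 0 <= c * d by rewrite mulr_ge0.
pose r := (diag_mx (mon_head Q), diag_mx (f (mon_head Q))) ::
  [seq (a kb.1 * diag_mx kb.2, a kb.1 * diag_mx (f kb.2)) | kb <- mon_tail Q].
have rP q : q \in r -> [/\ sqbounded (c * c) q.1, sqbounded (c * c) q.2 &
    sqbounded (c * d) (q.1 - q.2)].
  rewrite inE => /predU1P[->|] /=.
    have [|b1 b2 b3] := bc (mon_head Q); first by rewrite mem_head.
    by split; [apply: sqbounded_le b1|apply: sqbounded_le b2|apply: sqbounded_le b3];
      rewrite ler_peMl.
  (* [K] has no decidable equality, hence the membership in [Prop] *)
  have bc' kb : List.In kb (mon_tail Q) -> kb.2 \in coefs Q.
    rewrite /coefs inE; elim: (mon_tail Q) => //= kb' s IH [->|/IH].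
      by rewrite mem_head orbT.
    by rewrite inE => /orP[|] ->; rewrite ?orbT.
  move: bc'; elim: (mon_tail Q) => //= kb s IH bc'; rewrite inE => /predU1P[->|].
    have [|b1 b2 b3] := bc kb.2; first by apply: bc'; left.
    split; rewrite /= -?mulrBr.
    - exact: (sqbounded_mul c0 (ac kb.1) b1).
    - exact: (sqbounded_mul c0 (ac kb.1) b2).
    exact: (sqbounded_mul c0 (ac kb.1) b3).
  by apply: IH => kb' kb's; apply: bc'; right.
have sizer : (size r <= D.+1)%N by rewrite /= size_map ltnS.
have [] := sqbounded_prod_perturb cc1 cd0 rP.
rewrite !big_cons !big_map /= => p1 p2 p3.
have ev : mon_eval (map_coefs f Q) a = diag_mx (f (mon_head Q)) *
    \prod_(j <- mon_tail Q) (a j.1 * diag_mx (f j.2)).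
  by rewrite /mon_eval /= big_map.
have cX : (c * c) ^+ size r <= (c * c) ^+ D.+1 by apply: ler_weXn2l.
rewrite ev; split; [apply: sqbounded_le p1|apply: sqbounded_le p2|apply: sqbounded_le p3] => //.
rewrite ler_wpM2l //; apply: ler_weXn2l => //.
by rewrite mulr_ege1 // ler1n.
Qed.

(** The rounded coefficients are constant on the colours, hence are fixed by the
    colour preserving permutations. *)
Lemma mon_eval_perm_conj (s : {perm 'I_N}) f Q (a : K -> 'M[R[i]]_N) :
    (forall b x, f b 0 (s x) = f b 0 x) ->
  mon_eval (map_coefs f Q) (fun k => perm_conj s (a k)) =
  perm_conj s (mon_eval (map_coefs f Q) a).
Proof.
move=> fs; have diagE b : perm_conj s (diag_mx (f b)) = diag_mx (f b).
  by apply/matrixP => x y; rewrite !mxE (inj_eq perm_inj) fs.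
rewrite /mon_eval perm_conjM diagE perm_conj_prod !big_map; congr (_ * _).
by apply: eq_bigr => kb _; rewrite perm_conjM diagE.
Qed.

End Coefficients.

Lemma sub_entry (R : realType) (N : nat) (A B : 'M[R[i]]_N) x y :
  (A - B) x y = A x y - B x y.
Proof. by rewrite !mxE. Qed.

Section Defect.
Variables (R : realType) (K : Type) (L n : nat) (l : 'I_n -> 'I_L).
Hypothesis n_gt0 : (0 < n)%N.
Hypothesis l_neq : forall i j : 'I_n, j = i.+1 :> nat -> l i <> l j.

Section FixedSize.
Variable N : nat.
Implicit Types (P : 'I_n -> monomial R K N) (a : 'I_L -> K -> 'M[R[i]]_N).

Definition block P a (i : 'I_n) : 'M[R[i]]_N := centred (mon_eval (P i) (a (l i))).

Lemma freeness_defectE P a x :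
  freeness_defect a l P x x = (\prod_(i < n) block P a i) x x.
Proof. by rewrite mxE eqxx mul1r. Qed.

Definition block_bound (c : R[i]) D : R[i] := 4 * (c * c) ^+ D.+1.

Definition perturb_bound (c : R[i]) D : R[i] :=
  4 * (c * (4 * (c * c)) ^+ D.+1) * (4 * block_bound c D) ^+ n.

Lemma blocks_perturb (c d : R[i]) D f P a : 1 <= c -> 0 <= d ->
    (forall i, (mon_degree (P i) <= D)%N) -> (forall m k, sqbounded c (a m k)) ->
    (forall i b, b \in coefs (P i) -> [/\ sqbounded c (diag_mx b),
       sqbounded c (diag_mx (f b)) & sqbounded d (diag_mx b - diag_mx (f b))]) ->
  [/\ forall i, sqbounded (block_bound c D) (block (fun i => map_coefs f (P i)) a i),
      sqbounded (block_bound c D ^+ n) (\prod_(i < n) block P a i) &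
      sqbounded (d * perturb_bound c D) (\prod_(i < n) block P a i -
        \prod_(i < n) block (fun i => map_coefs f (P i)) a i)].
Proof.
move=> c1 d0 PD ac bc; have c0 : 0 <= c by apply: le_trans c1.
have pert i := mon_eval_perturb c1 d0 (PD i) (ac (l i)) (bc i).
have e1 : 1 <= block_bound c D.
  by rewrite mulr_ege1 ?ler1n // exprn_ege1 // mulr_ege1.
have d1 : 0 <= 4 * (c * d * (4 * (c * c)) ^+ D.+1).
  by rewrite !mulr_ge0 // exprn_ge0 // !mulr_ge0.
pose r := [seq (block P a i, block (fun i => map_coefs f (P i)) a i) | i <- index_enum _].
have rP q : q \in r -> [/\ sqbounded (block_bound c D) q.1,
    sqbounded (block_bound c D) q.2 &
    sqbounded (4 * (c * d * (4 * (c * c)) ^+ D.+1)) (q.1 - q.2)].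
  move=> /mapP[i _ ->] /=; have [p1 p2 p3] := pert i.
  by split; [exact: sqbounded_centred..|rewrite centredB; apply: sqbounded_centred].
have [] := sqbounded_prod_perturb e1 d1 rP.
have -> : size r = n by rewrite size_map -[index_enum _]enumT size_enum_ord.
rewrite !big_map /= => p1 _ p3; split=> //.
  by move=> i; have [_ p2 _] := pert i; apply: sqbounded_centred.
apply: sqbounded_le p3; rewrite le_eqVlt; apply/orP; left; apply/eqP.
by rewrite /perturb_bound; ring.
Qed.

Lemma prod_scale (s : R[i]) (r : seq 'I_n) (F : 'I_n -> 'M[R[i]]_N) :
  \prod_(i <- r) (s *: F i) = s ^+ size r *: \prod_(i <- r) F i.
Proof.
elim: r => [|i r IH]; first by rewrite !big_nil scale1r.
rewrite !big_cons IH exprS -!mulmxE -scalemxAl -scalemxAr scalerA //.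
Qed.

(** By homogeneity, from the case of contractions. *)
Lemma rounded_average_le (e : R[i]) (Col : finType) (c : 'I_N -> Col)
    (B : 'I_n -> 'M[R[i]]_N) : 0 < e -> (forall i, sqbounded e (B i)) ->
    (forall i x, B i x x = 0) ->
  \sum_(g : {ffun 'I_L -> {perm 'I_N}} | g \in ffun_on (mem (colour_perms c)))
    \sum_x `|(\prod_(i < n) perm_conj (g (l i)) (B i)) x x| ^+ 2 <=
  e ^+ n * (sqrtC N%:R * (#|colour_perms c| ^ L)%:R * (word_const L n Col)%:R).
Proof.
move=> e0 Be Bdiag; pose s := sqrtC e.
have s0 : 0 < s by rewrite sqrtC_gt0.
have s2 : s ^+ 2 = e by rewrite sqrtCK.
pose F i := s^-1 *: B i.
have BE i : B i = s *: F i by rewrite scalerA mulfV ?scale1r // gt_eqF.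
have B'c i : contraction (F i).
  apply: sqbounded_le (sqbounded_scale (s^-1) (Be i)).
  by rewrite normfV gtr0_norm // exprVn s2 mulVf // gt_eqF.
have B'd i x : F i x x = 0 by rewrite mxE Bdiag mulr0.
have := word_average_le c n_gt0 l_neq B'c B'd.
rewrite -(ler_pM2l (exprn_gt0 n e0)); apply: le_trans.
rewrite mulr_sumr le_eqVlt; apply/orP; left; apply/eqP; apply: eq_bigr => g _.
rewrite mulr_sumr; apply: eq_bigr => x _.
rewrite (eq_bigr (fun i => s *: perm_conj (g (l i)) (F i))) => [|i _]; last first.
  by rewrite BE; apply/matrixP => y z; rewrite !mxE.
rewrite prod_scale mxE normrM exprMn normrX gtr0_norm //.
by rewrite -[index_enum _]enumT size_enum_ord exprAC s2.
Qed.

End FixedSize.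

(** The bound is uniform in [N] and in the polynomials: the number of colours
    depends only on [d], on the bound [c] on the coefficients and on the number
    of coefficients. *)
Theorem defect_average_le (c : R) (D : nat) : 1 <= c ->
  exists k : R, 0 <= k /\ forall d : R, 0 < d -> exists k' : R, 0 <= k' /\
  forall (N : nat) (P : 'I_n -> monomial R K N),
    (forall i, (mon_degree (P i) <= D)%N) ->
    (forall i b x, b \in coefs (P i) -> `|b 0 x| ^+ 2 <= c%:C) ->
  exists G : {set {perm 'I_N}}, (0 < #|G|)%N /\
  forall a : 'I_L -> K -> 'M[R[i]]_N, (forall m k, sqbounded c%:C (a m k)) ->
  \sum_(g : {ffun 'I_L -> {perm 'I_N}} | g \in ffun_on (mem G))
    \sum_x `|freeness_defect (fun m k => perm_conj (g m) (a m k)) l P x x| ^+ 2 <=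
  ((#|G| ^ L)%:R * (N%:R * (d * k) + k' * Num.sqrt N%:R))%:C.
Proof.
move=> c1; have c1C : 1 <= c%:C :> R[i] by rewrite (lecR 1 c).
have c0C : 0 <= c%:C :> R[i] by apply: le_trans c1C.
have reC (z : R[i]) : 0 <= z -> z = (complex.Re z)%:C.
  by move=> z0; rewrite RRe_real // ger0_real.
have e0 : 0 < block_bound c%:C D.
  rewrite pmulr_rgt0 ?ltr0n // exprn_gt0 // mulr_gt0 //; exact: lt_le_trans c1C.
have pb0 : 0 <= perturb_bound c%:C D.
  rewrite !mulr_ge0 ?exprn_ge0 // ?mulr_ge0 ?exprn_ge0 ?(ltW e0) //.
  by rewrite mulr_ge0 // mulr_ge0.
exists (complex.Re (2 * perturb_bound c%:C D)); split.
  by rewrite -ler0c -reC // mulr_ge0.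
move=> d d0; have [Q [q qE]] := quantise c d0.
pose Col := {ffun 'I_n * 'I_D.+1 -> Q}.
pose K' : R[i] := 2 * (block_bound c%:C D ^+ n * (word_const L n Col)%:R).
have K'0 : 0 <= K' by rewrite !mulr_ge0 // exprn_ge0 // ltW.
exists (complex.Re K'); split; first by rewrite -ler0c -reC.
move=> N P PD Pc.
(* the default [0] of [nth] only occurs beyond the last coefficient *)
pose col (x : 'I_N) : Col :=
  [ffun ij : 'I_n * 'I_D.+1 => q ((nth 0 (coefs (P ij.1)) ij.2) 0 x)].
(* the rounded coefficient takes at [x] the value of the coefficient at a fixed
   representative of the colour of [x] *)
pose rep x := odflt x [pick y | col y == col x].
have repE x y : col x = col y -> rep x = rep y.
  rewrite /rep => E; rewrite (eq_pick (Q := [pred z | col z == col y])).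
    by case: pickP => // /(_ y) /=; rewrite eqxx.
  by move=> z /=; rewrite E.
have colrep x : col (rep x) = col x.
  by rewrite /rep; case: pickP => [y /eqP|].
pose f (b : 'rV[R[i]]_N) : 'rV[R[i]]_N := \row_x b 0 (rep x).
exists (colour_perms col); split; first exact: colour_perms_gt0.
move=> a ac.
have coefP i b : b \in coefs (P i) -> [/\ sqbounded c%:C (diag_mx b),
    sqbounded c%:C (diag_mx (f b)) & sqbounded d%:C (diag_mx b - diag_mx (f b))].
  move=> bP; split.
  - by apply: sqbounded_diag => x; apply: Pc bP.
  - by apply: sqbounded_diag => x; rewrite mxE; apply: Pc bP.
  rewrite -linearB /=; apply: sqbounded_diag => x; rewrite !mxE.
  apply: qE; [exact: Pc bP|exact: Pc bP|].
  have jD : (index b (coefs (P i)) < D.+1)%N.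
    apply: (@leq_trans (size (coefs (P i)))); first by rewrite index_mem.
    by rewrite /= size_map ltnS PD.
  have := congr1 (fun h : Col => h (i, Ordinal jD)) (colrep x).
  by rewrite !ffunE /= nth_index // => ->.
pose B i := block (fun i => map_coefs f (P i)) a i.
have blockE g i : g \in ffun_on (mem (colour_perms col)) ->
    block (fun i => map_coefs f (P i)) (fun m k => perm_conj (g m) (a m k)) i =
    perm_conj (g (l i)) (B i).
  move=> /ffun_onP/(_ (l i)) /colour_permsP gcol.
  rewrite /B /block -centred_perm_conj; congr centred.
  rewrite -mon_eval_perm_conj // => b x.
  by rewrite !mxE (repE _ _ (gcol x)).
pose W (g : {ffun 'I_L -> {perm 'I_N}}) x :=
  (\prod_(i < n) perm_conj (g (l i)) (B i)) x x.
have ptw g x : g \in ffun_on (mem (colour_perms col)) ->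
    `|freeness_defect (fun m k => perm_conj (g m) (a m k)) l P x x| ^+ 2 <=
    2 * `|W g x| ^+ 2 + d%:C * (2 * perturb_bound c%:C D).
  move=> gG; rewrite freeness_defectE.
  have d0C : 0 <= d%:C :> R[i] by rewrite ler0c ltW.
  have ac' m k : sqbounded c%:C (perm_conj (g m) (a m k)).
    exact: sqbounded_perm_conj.
  pose ga := fun m k => perm_conj (g m) (a m k).
  pose U := \prod_(i < n) block P ga i.
  pose U' := \prod_(i < n) block (fun i => map_coefs f (P i)) ga i.
  have pert : sqbounded (d%:C * perturb_bound c%:C D) (U - U').
    by have [] := blocks_perturb c1C d0C PD ac' coefP.
  have U'E : U' x x = W g x.
    by congr (fun_of_matrix _ x x); apply: eq_bigr => i _; apply: blockE.
  have le1 : `|U x x - W g x| ^+ 2 <= d%:C * perturb_bound c%:C D.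
    by rewrite -U'E -sub_entry; exact: (sqbounded_entry pert x x).
  apply: (@le_trans _ _ (2 * `|W g x| ^+ 2 + 2 * `|U x x - W g x| ^+ 2)).
    rewrite -subr_ge0 (_ : _ - _ = `|U x x - 2 * W g x| ^+ 2) ?exprn_ge0 //.
    by rewrite !normCK !rmorphB rmorphM /= conjC_nat; ring.
  by rewrite lerD2l [leRHS]mulrCA ler_wpM2l.
apply: (@le_trans _ _ (\sum_(g : {ffun 'I_L -> {perm 'I_N}} |
    g \in ffun_on (mem (colour_perms col)))
    \sum_x (2 * `|W g x| ^+ 2 + d%:C * (2 * perturb_bound c%:C D)))).
  by apply: ler_sum => g gG; apply: ler_sum => x _; apply: ptw.
under eq_bigr do rewrite big_split /= sumr_const card_ord -mulr_sumr.
rewrite big_split /= sumr_const card_ffun_on card_ord -mulr_sumr.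
have d0C : 0 <= d%:C :> R[i] by rewrite ler0c ltW.
have [B1 _ _] := blocks_perturb c1C d0C PD ac coefP.
have avg := rounded_average_le col e0 B1 (fun i x => centred_diag _ x).
have sqrtE : (Num.sqrt N%:R)%:C = sqrtC N%:R :> R[i].
  by rewrite -[LHS]sqrCK ?ler0c ?sqrtr_ge0 // -rmorphXn sqr_sqrtr // rmorph_nat.
have -> : ((#|colour_perms col| ^ L)%:R * (N%:R * (d * complex.Re (2 * perturb_bound c%:C D)) +
    complex.Re K' * Num.sqrt N%:R))%:C =
  (#|colour_perms col| ^ L)%:R * (N%:R * (d%:C * (2 * perturb_bound c%:C D)) +
    K' * sqrtC N%:R) :> R[i].
  rewrite !(rmorphM, rmorphD, rmorph_nat) /= sqrtE -!reC //.
  by rewrite mulr_ge0.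
rewrite mulrDr [leRHS]addrC lerD //.
  apply: le_trans (ler_wpM2l _ avg) _; first by [].
  by rewrite le_eqVlt /K'; apply/orP; left; apply/eqP; ring.
by rewrite -[leLHS]mulr_natl -[X in _ * X <= _]mulr_natl.
Qed.

End Defect.

(** * Invariance of the joint law *)

Local Open Scope classical_set_scope.
Local Open Scope ring_scope.
Local Open Scope complex_scope.

Lemma perm_conjE (R : realType) (N : nat) (s : {perm 'I_N}) (A : 'M[R[i]]_N) :
  perm_mx s *m A *m invmx (perm_mx s) = perm_conj s A.
Proof.
apply: (canLR (mulmxK (unitmx_perm _ s))); rewrite -row_permE.
have -> : perm_conj s A = col_perm s (row_perm s A).
  by apply/matrixP => x y; rewrite !mxE.
by rewrite col_permE -mulmxA -perm_mxM mulVg perm_mx1 mulmx1.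
Qed.

Section JointLaw.
Variables (R : realType) (K : Type) (N L : nat).

(** A copy of the space of [L]-tuples of families, pointed so that it can carry
    a structure of measurable space. *)
Definition families : Type := 'I_L -> K -> 'M[R[i]]_N.

HB.instance Definition _ := gen_eqMixin families.
HB.instance Definition _ := gen_choiceMixin families.
HB.instance Definition _ := isPointed.Build families (fun _ _ => 0).

(** They generate the product sigma-algebra of the [L] copies of [family_sigma]. *)
Definition rectangles : set (set families) :=
  [set E | exists2 F : 'I_L -> set (K -> 'M[R[i]]_N),
     (forall m, family_sigma (F m)) & E = [set a | forall m, F m (a m)]].

Notation joint := (g_sigma_algebraType rectangles).

Definition permute_families (g : 'I_L -> {perm 'I_N}) (a : families) : families :=
  fun m k => perm_conj (g m) (a m k).

Lemma family_sigma_setI :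
  family_sigma (@setT (K -> 'M[R[i]]_N)) /\ setI_closed (@family_sigma R K N).
Proof.
have [] // : [/\ family_sigma (@setT (K -> 'M[R[i]]_N)),
    setSD_closed (@family_sigma R K N), ndseq_closed (@family_sigma R K N) &
    setI_closed (@family_sigma R K N)].
by apply/sigma_algebraP => //; apply: smallest_sigma_algebra.
Qed.

Lemma setI_closed_rectangles : setI_closed rectangles.
Proof.
move=> _ _ [F mF ->] [F' mF' ->]; exists (fun m => F m `&` F' m).
  by move=> m; apply: (proj2 family_sigma_setI).
by apply/seteqP; split=> a /= => [[a1 a2] m|H]; split=> // m; have [] := H m.
Qed.

Lemma family_sigma_conj (s : {perm 'I_N}) (F : set (K -> 'M[R[i]]_N)) :
  family_sigma F -> family_sigma [set a | F (fun k => perm_conj s (a k))].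
Proof.
pose h (a : K -> 'M[R[i]]_N) k := perm_conj s (a k).
suff : @family_sigma R K N `<=` image_set_system setT h (@family_sigma R K N).
  by move=> /[apply]; rewrite /image_set_system /= setTI.
apply: smallest_sub.
  by apply: sigma_algebra_image; apply: smallest_sigma_algebra.
move=> E [k [x [y [B [mB EB]]]]]; rewrite /image_set_system /= setTI.
apply: sub_sigma_algebra; exists k, (s x), (s y), B; split=> //.
by case: EB => ->; [left|right]; apply/seteqP; split=> a /=; rewrite mxE.
Qed.

Variables (d : measure_display) (T : measurableType d) (P : probability T R).

Lemma random_family_preimage (X : T -> K -> 'M[R[i]]_N) F :
  random_family X -> family_sigma F -> measurable (X @^-1` F).
Proof.
move=> mX; suff : @family_sigma R K N `<=` image_set_system setT X measurable.
  by move=> /[apply]; rewrite /image_set_system /= setTI.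
apply: smallest_sub.
  apply: sigma_algebra_image; exact: sigma_algebra_measurable.
move=> E [k [x [y [B [mB EB]]]]]; rewrite /image_set_system /=.
have [m1 m2] := mX k x y.
by case: EB => ->; [apply: m1|apply: m2].
Qed.

Variable A : 'I_L -> T -> K -> 'M[R[i]]_N.
Hypothesis A_random : forall m, random_family (A m).
Hypothesis A_indep : independent_families P A.
Hypothesis A_perm : forall m, permutation_invariant P (A m).

Definition joint_map (w : T) : joint := fun m => A m w.

Lemma random_family_conj (g : 'I_L -> {perm 'I_N}) m :
  random_family (fun w k => perm_conj (g m) (A m w k)).
Proof.
move=> k x y; have [m1 m2] := A_random m k (g m x) (g m y).
by split; [move: m1|move: m2]; congr measurable_fun;
  apply/funext => w; rewrite mxE.
Qed.

Lemma measurable_joint (X : 'I_L -> T -> K -> 'M[R[i]]_N) :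
  (forall m, random_family (X m)) ->
  measurable_fun setT ((fun w m => X m w) : T -> joint).
Proof.
move=> mX; apply: (@measurability _ _ T joint setT _ rectangles) => //.
move=> _ [_ [F mF ->] <-].
rewrite setTI (_ : _ @^-1` _ = \bigcap_(m in [set: 'I_L]) (X m @^-1` F m)).
  apply: fin_bigcap_measurable => // m _; exact: random_family_preimage.
by apply/seteqP; split=> w /= H m; [move=> _|]; apply: H.
Qed.

(** Independence factorises the probability of a rectangle, and each factor is
    invariant.  Independence of the conjugated families follows by moving the
    conjugation to the sides of the rectangle. *)
Lemma permute_rectangle (g : 'I_L -> {perm 'I_N}) E : rectangles E ->
  P (joint_map @^-1` E) = P ((permute_families g \o joint_map) @^-1` E).
Proof.
move=> [F mF ->].
have -> : joint_map @^-1` [set a | forall m, F m (a m)] =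
    \bigcap_(m in [set: 'I_L]) (A m @^-1` F m).
  by apply/seteqP; split=> w /= H m; [move=> _|]; apply: H.
pose F' m := [set a : K -> 'M[R[i]]_N | F m (fun k => perm_conj (g m) (a k))].
have -> : (permute_families g \o joint_map) @^-1` [set a | forall m, F m (a m)] =
    \bigcap_(m in [set: 'I_L]) (A m @^-1` F' m).
  by apply/seteqP; split=> w /= H m; [move=> _|]; apply: H.
rewrite !A_indep // => [|m]; last exact: family_sigma_conj.
apply: eq_bigr => m _; rewrite (A_perm m (perm_mx_is_perm _ (g m)) (mF m)).
have -> : (fun w k => perm_mx (g m) *m A m w k *m invmx (perm_mx (g m))) =
    (fun w k => perm_conj (g m) (A m w k)).
  by apply/funext => w; apply/funext => k; rewrite perm_conjE.
by [].
Qed.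

(** The rectangles are stable under intersection and generate, so that the two
    image measures agree. *)
Lemma integral_permute (g : 'I_L -> {perm 'I_N}) (h : joint -> R) :
  measurable_fun setT h -> (forall a, 0 <= h a) ->
  (\int[P]_w (h (joint_map w))%:E = \int[P]_w (h (permute_families g (joint_map w)))%:E)%E.
Proof.
move=> mh h0.
have m1 : measurable_fun setT joint_map by apply: measurable_joint.
have m2 : measurable_fun setT (permute_families g \o joint_map : T -> joint).
  by apply: measurable_joint => m; apply: random_family_conj.
have mhE : measurable_fun [set: joint] (fun a : joint => (h a)%:E) by exact/measurable_EFinP.
transitivity (\int[pushforward P joint_map]_a (h a)%:E)%E.
  by rewrite ge0_integral_pushforward // => a _; rewrite lee_fin.
transitivity (\int[pushforward P (permute_families g \o joint_map : T -> joint)]_a (h a)%:E)%E;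
  last by rewrite ge0_integral_pushforward // => a _; rewrite lee_fin.
apply: eq_measure_integral => E mE _.
apply: (@measure_unique _ R joint rectangles (fun=> setT)) => //.
- exact: setI_closed_rectangles.
- move=> _; exists (fun=> setT) => //; last by apply/seteqP; split.
  by move=> m; apply: (proj1 family_sigma_setI).
- by apply/seteqP; split=> // a _; exists 0%N.
- by move=> B /(permute_rectangle g).
by move=> _; have := probability_setT P; rewrite -(preimage_setT joint_map) => E1;
  apply: le_lt_trans (ltry 1); rewrite -E1.
Qed.

End JointLaw.

(** * Traces and measurability *)

Section TracePower.
Variables (R : realType) (N : nat).
Implicit Types (A : 'M[R[i]]_N).

Definition sqmod (z : R[i]) : R := complex.Re z ^+ 2 + complex.Im z ^+ 2.

Lemma sqmodE z : (sqmod z)%:C = `|z| ^+ 2.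
Proof. exact: add_Re2_Im2. Qed.

Lemma sqmod_ge0 z : 0 <= sqmod z.
Proof. by rewrite addr_ge0 ?sqr_ge0. Qed.

Lemma ntrace_diag_power A p :
  complex.Re (ntrace ((diag_part A * adjoint (diag_part A)) ^+ p)) =
  N%:R^-1 * \sum_x sqmod (A x x) ^+ p.
Proof.
have powE : (diag_part A * adjoint (diag_part A)) ^+ p =
    diag_mx (\row_x (sqmod (A x x) ^+ p)%:C).
  have sqE : diag_part A * adjoint (diag_part A) = diag_mx (\row_x (sqmod (A x x))%:C).
    apply/matrixP => x y; rewrite mxE (bigD1 x) //= big1 ?addr0.
      rewrite !mxE eqxx mul1r sqmodE normCK eq_sym.
      by have [->|_] := eqVneq x y; rewrite ?mul1r ?mulr1n // mul0r rmorph0 mulr0 mulr0n.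
    by move=> z; rewrite !mxE eq_sym => /negPf ->; rewrite !mul0r.
  rewrite sqE; elim: p => [|p IH].
    by rewrite expr0; apply/matrixP => x y; rewrite !mxE expr0 rmorph1.
  rewrite exprS IH -mulmxE; apply/matrixP => x y; rewrite mul_diag_mx !mxE.
  by rewrite exprS rmorphM mulrnAr.
rewrite powE /ntrace mxtrace_diag.
under eq_bigr do rewrite mxE.
rewrite -rmorph_sum -(rmorph_nat (real_complex R)) -fmorphV -rmorphM //=.
Qed.

End TracePower.

Section MeasurableMatrices.
Variables (R : realType) (d : measure_display) (T : measurableType d) (N : nat).

Definition cmeasurable (F : T -> R[i]) : Prop :=
  measurable_fun setT (fun w => complex.Re (F w)) /\
  measurable_fun setT (fun w => complex.Im (F w)).

Definition mxmeasurable (F : T -> 'M[R[i]]_N) : Prop :=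
  forall x y, cmeasurable (fun w => F w x y).

Lemma cmeasurable_cst z : cmeasurable (fun=> z).
Proof. by split; apply: measurable_cst. Qed.

Lemma cmeasurableB F G : cmeasurable F -> cmeasurable G ->
  cmeasurable (fun w => F w - G w).
Proof.
move=> [F1 F2] [G1 G2]; split.
  under eq_fun do rewrite raddfB; exact: measurable_funB.
under eq_fun do rewrite raddfB; exact: measurable_funB.
Qed.

Lemma cmeasurableM F G : cmeasurable F -> cmeasurable G ->
  cmeasurable (fun w => F w * G w).
Proof.
move=> [F1 F2] [G1 G2]; split.
  rewrite (_ : (fun w => _) = (fun w => complex.Re (F w) * complex.Re (G w) -
      complex.Im (F w) * complex.Im (G w))).
    by apply: measurable_funB; apply: measurable_funM.
  by apply/funext => w; case: (F w) (G w) => a b [].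
rewrite (_ : (fun w => _) = (fun w => complex.Re (F w) * complex.Im (G w) +
      complex.Im (F w) * complex.Re (G w))).
  by apply: measurable_funD; apply: measurable_funM.
by apply/funext => w; case: (F w) (G w) => a b [].
Qed.

Lemma cmeasurable_sum (I : Type) (s : seq I) (F : I -> T -> R[i]) :
  (forall j, cmeasurable (F j)) -> cmeasurable (fun w => \sum_(j <- s) F j w).
Proof.
move=> mF; split; under eq_fun do rewrite raddf_sum.
  by apply: measurable_sum => j; have [] := mF j.
by apply: measurable_sum => j; have [] := mF j.
Qed.

Lemma mxmeasurable_cst A : mxmeasurable (fun=> A).
Proof. by move=> x y; apply: cmeasurable_cst. Qed.

Lemma mxmeasurableM F G : mxmeasurable F -> mxmeasurable G ->
  mxmeasurable (fun w => F w * G w).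
Proof.
move=> mF mG x y; under eq_fun do rewrite mxE.
by apply: cmeasurable_sum => z; apply: cmeasurableM.
Qed.

Lemma mxmeasurable_prod (I : Type) (s : seq I) (F : I -> T -> 'M[R[i]]_N) :
  (forall j, mxmeasurable (F j)) -> mxmeasurable (fun w => \prod_(j <- s) F j w).
Proof.
move=> mF; elim: s => [|j s IH].
  under eq_fun do rewrite big_nil; exact: mxmeasurable_cst.
under eq_fun do rewrite big_cons; exact: mxmeasurableM.
Qed.

Lemma mxmeasurable_centred F : mxmeasurable F -> mxmeasurable (fun w => centred (F w)).
Proof.
move=> mF x y; under eq_fun do rewrite /centred !mxE.
apply: cmeasurableB; first exact: mF.
by apply: cmeasurableM; [exact: cmeasurable_cst|exact: mF].
Qed.

Lemma mxmeasurable_mon_eval (K : Type) (Q : monomial R K N) (a : T -> K -> 'M[R[i]]_N) :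
  (forall k, mxmeasurable (fun w => a w k)) -> mxmeasurable (fun w => mon_eval Q (a w)).
Proof.
move=> ma; apply: mxmeasurableM; first exact: mxmeasurable_cst.
apply: mxmeasurable_prod => kb; apply: mxmeasurableM ; first exact: ma.
exact: mxmeasurable_cst.
Qed.

Lemma measurable_sqmod F : cmeasurable F -> measurable_fun setT (fun w => sqmod (F w)).
Proof.
by move=> [F1 F2]; apply: measurable_funD; apply: measurable_funX.
Qed.

End MeasurableMatrices.

(** * Expectation of the freeness defect *)

Section DefectMoments.
Variables (R : realType) (K : Type) (N L n : nat) (l : 'I_n -> 'I_L).
Variable Q : 'I_n -> monomial R K N.

(** The normalised trace of the [p]-th power of [eps * eps^*], as a function of
    the families of matrices. *)
Definition defect_moment (p : nat) (a : 'I_L -> K -> 'M[R[i]]_N) : R :=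
  N%:R^-1 * \sum_x sqmod (freeness_defect a l Q x x) ^+ p.

Lemma defect_moment_ge0 p a : 0 <= defect_moment p a.
Proof.
rewrite mulr_ge0 ?invr_ge0 //; apply: sumr_ge0 => x _.
by rewrite exprn_ge0 // sqmod_ge0.
Qed.

Lemma defect_momentE p a :
  complex.Re (ntrace ((freeness_defect a l Q * adjoint (freeness_defect a l Q)) ^+ p)) =
  defect_moment p a.
Proof.
rewrite ntrace_diag_power; congr (_ * _); apply: eq_bigr => x _.
by rewrite /freeness_defect !mxE eqxx mul1r.
Qed.

Local Notation joint := (g_sigma_algebraType (@rectangles R K N L)).

Lemma measurable_defect_moment p : measurable_fun [set: joint] (defect_moment p : joint -> R).
Proof.
(* the condition on one entry is a rectangle with one nontrivial side *)
have ment m k : mxmeasurable (fun a : joint => a m k).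
  move=> x y; split; move=> _ B mB; rewrite setTI; apply: sub_sigma_algebra;
  [exists (fun m' => if m' == m then
     [set b : K -> 'M[R[i]]_N | B (complex.Re (b k x y))] else setT)|
   exists (fun m' => if m' == m then
     [set b : K -> 'M[R[i]]_N | B (complex.Im (b k x y))] else setT)].
  - move=> m'; case: ifP => _; last exact: (proj1 (family_sigma_setI _ _ _)).
    by apply: sub_sigma_algebra; exists k, x, y, B; split=> //; left.
  - apply/seteqP; split=> [a /= aB m'|a /= /(_ m)]; last by rewrite eqxx.
    by case: eqP => [->|].
  - move=> m'; case: ifP => _; last exact: (proj1 (family_sigma_setI _ _ _)).
    by apply: sub_sigma_algebra; exists k, x, y, B; split=> //; right.
  - apply/seteqP; split=> [a /= aB m'|a /= /(_ m)]; last by rewrite eqxx.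
    by case: eqP => [->|].
apply: measurable_funM; first exact: measurable_cst.
apply: measurable_sum => x; apply: measurable_funX; apply: measurable_sqmod.
under eq_fun do rewrite freeness_defectE.
apply: mxmeasurable_prod => j; apply: mxmeasurable_centred.
apply: mxmeasurable_mon_eval => k; exact: ment.
Qed.

Variables (d : measure_display) (T : measurableType d) (P : probability T R).
Variable A : 'I_L -> T -> K -> 'M[R[i]]_N.
Hypothesis A_random : forall m, random_family (A m).
Hypothesis A_indep : independent_families P A.
Hypothesis A_perm : forall m, permutation_invariant P (A m).
Variable c : R.
Hypothesis A_bounded : {ae P, forall w, forall m k, sqbounded c%:C (A m w k)}.

Lemma measurable_moment_families p : measurable_fun setT
  (fun w => (defect_moment p (fun m => A m w))%:E).
Proof.
apply/measurable_EFinP; apply: (measurableT_comp (measurable_defect_moment p)).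
exact: measurable_joint.
Qed.

(** By invariance, the expectation is not changed when the families are
    conjugated by permutations; averaging over [g] turns a bound on the average
    over permutations into a bound on the expectation. *)
Lemma expectation_defect_le (G : {set {perm 'I_N}}) (b : R) : (0 < #|G|)%N -> 0 <= b ->
    (forall a : 'I_L -> K -> 'M[R[i]]_N, (forall m k, sqbounded c%:C (a m k)) ->
      \sum_(g : {ffun 'I_L -> {perm 'I_N}} | g \in ffun_on (mem G))
        \sum_x `|freeness_defect (fun m k => perm_conj (g m) (a m k)) l Q x x| ^+ 2 <=
      ((#|G| ^ L)%:R * b)%:C) ->
  (\int[P]_w (defect_moment 1 (fun m => A m w))%:E <= (N%:R^-1 * b)%:E)%E.
Proof.
move=> G0 b0 avg; pose h : joint -> R := defect_moment 1.
pose s := enum (ffun_on (mem G) : {pred {ffun 'I_L -> {perm 'I_N}}}).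
have sizes : size s = (#|G| ^ L)%N by rewrite -cardE card_ffun_on card_ord.
have mh : measurable_fun [set: joint] h by exact: measurable_defect_moment.
have mg (g : {ffun 'I_L -> {perm 'I_N}}) : measurable_fun setT
    (fun w => (h (permute_families g (joint_map A w)))%:E).
  apply/measurable_EFinP; apply: (measurableT_comp mh).
  by apply: measurable_joint => m; apply: random_family_conj.
have n0 : (0 < (#|G| ^ L)%:R :> R) by rewrite ltr0n expn_gt0 G0.
rewrite -(@lee_pmul2l _ (#|G| ^ L)%:R%:E) ?lte_fin //.
have -> : ((#|G| ^ L)%:R%:E * \int[P]_w (defect_moment 1 (fun m => A m w))%:E =
    \sum_(g <- s) \int[P]_w (h (permute_families g (joint_map A w)))%:E)%E.
  rewrite (eq_bigr (fun=> \int[P]_w (h (joint_map A w))%:E)%E) => [|g _]; last first.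
    exact/esym/(integral_permute A_random A_indep A_perm g mh (defect_moment_ge0 1)).
  rewrite -sizes; elim: s {sizes} => [|g s IH]; first by rewrite big_nil mul0e.
  rewrite big_cons -IH /= mulrS EFinD ge0_muleDl ?lee_fin ?mul1e //.
rewrite -ge0_integral_sum //; last first.
  by move=> g w _; rewrite lee_fin defect_moment_ge0.
apply: (@le_trans _ _ (\int[P]_w (cst ((#|G| ^ L)%:R * (N%:R^-1 * b))%:E w))%E); last first.
  rewrite integral_cst // [X in (_ * X)%E](_ : _ = 1%E) ?mule1 //.
  exact: probability_setT.
apply: ae_ge0_le_integral => //.
- move=> w _; apply: sume_ge0 => g _; rewrite lee_fin defect_moment_ge0 //.
- exact: emeasurable_sum.
- by move=> w _; rewrite /= lee_fin !mulr_ge0 ?invr_ge0.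
apply: filterS A_bounded => w bw _.
rewrite sumEFin lee_fin big_enum /=.
have le1 := avg (fun m => A m w) bw.
have sumE : \sum_(g : {ffun 'I_L -> {perm 'I_N}} | g \in ffun_on (mem G))
    \sum_x `|freeness_defect (fun m k => perm_conj (g m) (A m w k)) l Q x x| ^+ 2 =
  (\sum_(g : {ffun 'I_L -> {perm 'I_N}} | g \in ffun_on (mem G))
    \sum_x sqmod (freeness_defect (fun m k => perm_conj (g m) (A m w k)) l Q x x))%:C.
  rewrite rmorph_sum; apply: eq_bigr => g _; rewrite rmorph_sum.
  by apply: eq_bigr => x _; rewrite /= sqmodE.
rewrite sumE lecR in le1; rewrite mulrCA -mulr_sumr ler_wpM2l ?invr_ge0 //.
Qed.

End DefectMoments.

(** * Asymptotic freeness *)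

Section MomentBound.
Variables (R : realType) (K : Type) (L n : nat) (l : 'I_n -> 'I_L).
Hypothesis n_gt0 : (0 < n)%N.
Hypothesis l_neq : forall i j : 'I_n, j = i.+1 :> nat -> l i <> l j.

(** Rounding nothing in [blocks_perturb] leaves the bound on the product. *)
Lemma defect_entry_le (c : R) (D : nat) : 1 <= c -> exists r : R, 0 <= r /\
  forall (N : nat) (Q : 'I_n -> monomial R K N) (a : 'I_L -> K -> 'M[R[i]]_N),
    (forall i, (mon_degree (Q i) <= D)%N) ->
    (forall i b x, b \in coefs (Q i) -> `|b 0 x| ^+ 2 <= c%:C) ->
    (forall m k, sqbounded c%:C (a m k)) ->
  forall x, sqmod (freeness_defect a l Q x x) <= r.
Proof.
move=> c1; have c1C : 1 <= c%:C :> R[i] by rewrite (lecR 1 c).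
have c0C : 0 <= c%:C :> R[i] by apply: le_trans c1C.
have r0 : 0 <= block_bound c%:C D ^+ n.
  by rewrite exprn_ge0 // mulr_ge0 // exprn_ge0 // mulr_ge0.
have rE : (complex.Re (block_bound c%:C D ^+ n))%:C = block_bound c%:C D ^+ n.
  by rewrite RRe_real // ger0_real.
exists (complex.Re (block_bound c%:C D ^+ n)); split; first by rewrite -ler0c rE.
move=> N Q a QD Qc ac x.
have coefP i b : b \in coefs (Q i) -> [/\ sqbounded c%:C (diag_mx b),
    sqbounded c%:C (diag_mx (id b)) & sqbounded 0 (diag_mx b - diag_mx (id b))].
  move=> bQ; rewrite subrr; split; last exact: sqbounded0.
    by apply: sqbounded_diag => y; apply: Qc bQ.
  by apply: sqbounded_diag => y; apply: Qc bQ.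
have [_ bnd _] := blocks_perturb l c1C (lexx 0) QD ac coefP.
by rewrite -lecR rE sqmodE freeness_defectE; apply: sqbounded_entry bnd _ _.
Qed.

(** The term [d * k] is the cost of rounding the coefficients with precision [d];
    it does not vanish with [N], but [k] does not depend on [d].  The power
    [r ^+ p.-1] bounds the [p]-th moment by the first one. *)
Lemma expectation_moment_le (C B : R) (D p : nat) : (0 < p)%N ->
  exists k : R, 0 <= k /\ forall d : R, 0 < d -> exists k' : R, 0 <= k' /\
  forall (N : nat) (Q : 'I_n -> monomial R K N)
    (disp : measure_display) (T : measurableType disp) (P : probability T R)
    (A : 'I_L -> T -> K -> 'M[R[i]]_N),
    (0 < N)%N ->
    (forall i, (mon_degree (Q i) <= D)%N) ->
    (forall i b, b \in mon_coefs (Q i) -> opnorm b <= B) ->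
    (forall m, random_family (A m)) -> independent_families P A ->
    (forall m, permutation_invariant P (A m)) ->
    {ae P, forall w, forall m k, opnorm (A m w k) <= C} ->
  (\int[P]_w (defect_moment l Q p (fun m => A m w))%:E <=
   (d * k + k' / Num.sqrt N%:R)%:E)%E.
Proof.
move=> p0; pose c : R := 1 + C ^+ 2 + B ^+ 2.
have c1 : 1 <= c by rewrite /c -addrA lerDl addr_ge0 ?sqr_ge0.
have cC : C ^+ 2 <= c by rewrite /c addrAC lerDr addr_ge0 ?sqr_ge0.
have cB : B ^+ 2 <= c by rewrite /c lerDr addr_ge0 ?sqr_ge0.
have [r [r0 rP]] := defect_entry_le D c1.
have [k [k0 kP]] := defect_average_le K n_gt0 l_neq D c1.
exists (r ^+ p.-1 * k); split; first by rewrite mulr_ge0 ?exprn_ge0.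
move=> d d0; have [k' [k'0 k'P]] := kP d d0.
exists (r ^+ p.-1 * k'); split; first by rewrite mulr_ge0 ?exprn_ge0.
move=> N Q disp T P A N0 QD QB mA iA pA bA.
have Qc i b x : b \in coefs (Q i) -> `|b 0 x| ^+ 2 <= c%:C.
  move=> bQ; have bB : opnorm (diag_mx b) <= B.
    apply: QB (i) _ _; rewrite (_ : mon_coefs (Q i) = map diag_mx (coefs (Q i))).
      exact: map_f.
    by rewrite /coefs /= -map_comp.
  have := sqbounded_entry (opnorm_sqbounded bB) x x.
  by rewrite mxE eqxx mulr1n => /le_trans; apply; rewrite lecR.
have bA' : {ae P, forall w, forall m k, sqbounded c%:C (A m w k)}.
  apply: filterS bA => w bw m k0'; apply: sqbounded_le (opnorm_sqbounded (bw m k0')).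
  by rewrite lecR.
have [G [G0 GP]] := k'P N Q QD Qc.
set b := N%:R * (d * k) + k' * Num.sqrt N%:R in GP.
have b0 : 0 <= b by rewrite addr_ge0 ?mulr_ge0 ?sqrtr_ge0 // ltW.
have E1 := expectation_defect_le mA iA pA bA' G0 b0 GP.
have m1 := measurable_moment_families l Q mA 1.
have mp := measurable_moment_families l Q mA p.
apply: (@le_trans _ _ (\int[P]_w ((r ^+ p.-1)%:E *
    (defect_moment l Q 1 (fun m => A m w))%:E))%E).
  apply: ae_ge0_le_integral => //.
  - by move=> w _; rewrite lee_fin defect_moment_ge0.
  - by move=> w _; rewrite -EFinM lee_fin mulr_ge0 ?exprn_ge0 ?defect_moment_ge0.
  - exact: measurable_funeM.
  apply: filterS bA' => w bw _; rewrite -EFinM lee_fin.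
  rewrite mulrCA ler_wpM2l ?invr_ge0 // mulr_sumr; apply: ler_sum => x _.
  rewrite -[in leLHS](prednK p0) exprSr expr1 ler_wpM2r ?sqmod_ge0 //.
  by rewrite lerXn2r ?nnegrE ?sqmod_ge0 //; apply: rP.
rewrite ge0_integralZl_EFin ?exprn_ge0 //; last first.
  by move=> w _; rewrite lee_fin defect_moment_ge0.
apply: (@le_trans _ _ ((r ^+ p.-1)%:E * (N%:R^-1 * b)%:E)%E).
  by rewrite lee_wpmul2l // lee_fin exprn_ge0.
rewrite -EFinM lee_fin le_eqVlt; apply/orP; left; apply/eqP.
have s0 : Num.sqrt (N%:R : R) != 0 by rewrite sqrtr_eq0 -ltNge ltr0n.
have sN : (N%:R : R) = Num.sqrt N%:R ^+ 2 by rewrite sqr_sqrtr.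
rewrite /b sN sqrtr_sqr ger0_norm ?sqrtr_ge0 //.
by field; rewrite s0.
Qed.

End MomentBound.

(* The trace of a power of eps * eps^* is a nonnegative real, so that taking
   its real part only changes its type. *)
Theorem theorem1p2 (R : realType) (L : nat) (hL : (1 <= L)%N) (K : Type)
    (d : nat -> measure_display) (T : forall N : nat, measurableType (d N))
    (Pr : forall N : nat, probability (T N) R)
    (A : forall N : nat, 'I_L -> T N -> K -> 'M[R[i]]_N)
    (A_random : forall (N : nat) (l : 'I_L), random_family (A N l))
    (A_indep : forall N : nat, independent_families (Pr N) (A N))
    (A_bounded : exists C : R, forall N : nat,
       {ae Pr N, forall w, forall (l : 'I_L) (k : K), opnorm (A N l w k) <= C})
    (A_perm : forall (N : nat) (l : 'I_L),
       permutation_invariant (Pr N) (A N l))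
    (n : nat) (hn : (2 <= n)%N) (l : 'I_n -> 'I_L)
    (l_neq : forall i j : 'I_n, j = i.+1 :> nat -> l i <> l j)
    (P : forall N : nat, 'I_n -> monomial R K N)
    (P_degree : exists D : nat, forall (N : nat) (i : 'I_n),
       (mon_degree (P N i) <= D)%N)
    (P_coefs : exists B : R, forall (N : nat) (i : 'I_n) (b : 'M[R[i]]_N),
       b \in mon_coefs (P N i) -> opnorm b <= B)
    (p : nat) (hp : (1 <= p)%N) :
  let eps N (w : T N) : 'M[R[i]]_N :=
    freeness_defect (fun m => A N m w) l (P N) in
  (fun N => 'E_(Pr N)[fun w =>
     complex.Re (ntrace ((eps N w * adjoint (eps N w)) ^+ p))])%E
    @ \oo --> 0%E.
Proof.
move=> eps.
have [D PD] := P_degree; have [B PB] := P_coefs; have [C AC] := A_bounded.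
have n0 : (0 < n)%N by apply: leq_trans hn.
have [k [k0 kP]] := expectation_moment_le K n0 l_neq C B D hp.
pose E N := (\int[Pr N]_w (defect_moment l (P N) p (fun m => A N m w))%:E)%E.
have EE : (fun N => 'E_(Pr N)[fun w =>
    complex.Re (ntrace ((eps N w * adjoint (eps N w)) ^+ p))])%E = E.
  apply/funext => N; rewrite unlock; apply: eq_integral => w _.
  by rewrite /eps defect_momentE.
rewrite EE.
have E0 N : (0 <= E N)%E.
  by apply: integral_ge0 => w _; rewrite lee_fin defect_moment_ge0.
have Ele d0 : 0 < d0 -> exists k' : R, 0 <= k' /\ forall N, (0 < N)%N ->
    (E N <= (d0 * k + k' / Num.sqrt N%:R)%:E)%E.
  move=> /kP[k' [k'0 k'P]]; exists k'; split=> // N N0.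
  exact: (k'P _ _ _ _ _ _ N0 (PD N) (PB N) (A_random N) (A_indep N) (A_perm N) (AC N)).
have Efin N : (0 < N)%N -> E N \is a fin_num.
  have [k' [_ k'P]] := Ele 1 ltr01.
  by move=> /k'P le1; rewrite ge0_fin_numE //; apply: le_lt_trans le1 (ltry _).
apply: cvg_EFin.
  by near=> N; apply: Efin; near: N; exists 1%N.
apply/cvgr0Pnorm_lt => e e0.
(* the precision of the rounding is fixed first, then [N] is taken large *)
have e1 : 0 < e / (2 * (k + 1)) by rewrite divr_gt0 // mulr_gt0 // ltr_wpDl.
have [k' [k'0 k'P]] := Ele _ e1.
near=> N.
have N0 : (0 < N)%N by near: N; exists 1%N.
have NL : (2 * k' / e) ^+ 2 < N%:R.
  near: N; exists (Num.truncn ((2 * k' / e) ^+ 2)).+1 => // N' /= le1.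
  by apply: lt_le_trans (truncnS_gt _) _; rewrite ler_nat.
have /= := k'P N N0; rewrite -[E N]fineK ?Efin // lee_fin => le1.
rewrite /= ger0_norm ?fine_ge0 //; apply: le_lt_trans le1 _.
have s0 : 0 < Num.sqrt (N%:R : R) by rewrite sqrtr_gt0 ltr0n.
have lt1 : k' / Num.sqrt N%:R < e / 2.
  rewrite ltr_pdivrMr // mulrC -ltr_pdivrMr ?divr_gt0 //.
  rewrite -(@ltr_pXn2r _ 2) ?nnegrE ?divr_ge0 ?(ltW s0) ?(ltW e0) // sqr_sqrtr //.
  by apply: le_lt_trans NL; rewrite le_eqVlt; apply/orP; left; apply/eqP; field; rewrite gt_eqF.
have le2 : e / (2 * (k + 1)) * k <= e / 2.
  rewrite -mulrA ler_wpM2l ?(ltW e0) // -[leRHS]mulr1 invfM -mulrA.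
  rewrite ler_wpM2l ?invr_ge0 // mulrC ler_pdivrMr ?mul1r ?lerDl // ltr_wpDl //.
by rewrite [ltRHS](splitr e); apply: ler_ltD.
Unshelve. all: by end_near.
Qed.
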